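(* Let $T\in\mathcal{BC}(X)$, $m\in\mathbb N_0$, and let $U\subset\mathbb H$ be a bounded slice Cauchy domain with $\sigma_S(T)\subset U$. Then for every $J\in\mathbb S$, $$H_m(T)=\frac1{2\pi}\int_{\partial(U\cap\mathbb C_J)}\mathcal Q_{c,s}(T)^{-1}\,ds_J\,s^{m+1},\qquad\text{where } H_m(T):=\sum_{k=0}^mT^{m-k}\bar T^k.$$
   Context: $\mathbb H$ denotes the quaternions with units $e_1,e_2,e_3$; $\mathbb S$ is the sphere of unit purely imaginary quaternions and $\mathbb C_J=\{u+Jv:u,v\in\mathbb R\}$. $X=X_{\mathbb R}\otimes\mathbb H$ is a two-sided quaternionic Banach module over a real Banach space $X_{\mathbb R}$; $\mathcal{BC}(X)$ is the set of $T=T_0+T_1e_1+T_2e_2+T_3e_3$ with $T_i\in\mathcal B(X_{\mathbb R})$ pairwise commuting; $\bar T=T_0-\sum T_ie_i$; $\mathcal Q_{c,s}(T)=s^2\mathcal I-s(T+\bar T)+T\bar T$; $\sigma_S(T)$ is the set of $s$ for which $\mathcal Q_{c,s}(T)$ has no bounded inverse. A slice Cauchy domain is an axially symmetric open set $U$ (i.e. $u+Iv\in U$ implies $u+Jv\in U$ for all $J\in\mathbb S$) such that for each $J$ the boundary of $U\cap\mathbb C_J$ is a finite union of nonintersecting piecewise $C^1$ Jordan curves. Integrals are over positively oriented boundaries with $ds_J=ds(-J)$. *)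

(* Defs.v *)
From Stdlib Require Import Reals Lra List ClassicalEpsilon.
From Coquelicot Require Import Coquelicot.
Set Implicit Arguments.
Open Scope R_scope.

Record quat := mkQ { q0 : R; q1 : R; q2 : R; q3 : R }.

Definition qreal (r : R) : quat := mkQ r 0 0 0.
Definition qadd (p q : quat) : quat :=
  mkQ (q0 p + q0 q) (q1 p + q1 q) (q2 p + q2 q) (q3 p + q3 q).
Definition qopp (p : quat) : quat := mkQ (- q0 p) (- q1 p) (- q2 p) (- q3 p).
Definition qscal (r : R) (p : quat) : quat :=
  mkQ (r * q0 p) (r * q1 p) (r * q2 p) (r * q3 p).
(* Hamilton product, e1 e2 = e3, e2 e3 = e1, e3 e1 = e2, ei^2 = -1 *)
Definition qmul (a b : quat) : quat :=
  mkQ (q0 a * q0 b - q1 a * q1 b - q2 a * q2 b - q3 a * q3 b)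
      (q0 a * q1 b + q1 a * q0 b + q2 a * q3 b - q3 a * q2 b)
      (q0 a * q2 b - q1 a * q3 b + q2 a * q0 b + q3 a * q1 b)
      (q0 a * q3 b + q1 a * q2 b - q2 a * q1 b + q3 a * q0 b).
Fixpoint qpow (q : quat) (n : nat) : quat :=
  match n with O => qreal 1 | S k => qmul q (qpow q k) end.
Definition qnorm2 (q : quat) : R := q0 q ^ 2 + q1 q ^ 2 + q2 q ^ 2 + q3 q ^ 2.

Definition in_S (J : quat) : Prop := q0 J = 0 /\ q1 J ^ 2 + q2 J ^ 2 + q3 J ^ 2 = 1.

Definition emb (J : quat) (z : R * R) : quat := qadd (qreal (fst z)) (qscal (snd z) J).

Section Ops.
Variable X : CompleteNormedModule R_AbsRing.

Definition is_bop (f : X -> X) : Prop :=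
  (forall x y, f (plus x y) = plus (f x) (f y)) /\
  (forall (r : R) x, f (scal r x) = scal r (f x)) /\
  (exists M : R, forall x, norm (f x) <= M * norm x).

Definition fadd (f g : X -> X) : X -> X := fun x => plus (f x) (g x).
Definition fsub (f g : X -> X) : X -> X := fun x => plus (f x) (opp (g x)).
Definition fopp (f : X -> X) : X -> X := fun x => opp (f x).
Definition fcomp (f g : X -> X) : X -> X := fun x => f (g x).
Definition fscal (r : R) (f : X -> X) : X -> X := fun x => scal r (f x).
Definition fid : X -> X := fun x => x.
Definition fzero : X -> X := fun _ => zero.

(* A = A0 + A1 e1 + A2 e2 + A3 e3 with Ai operators on X_R: the (right linear)
   operators on X_R (x) H, acting by (A x)(v (x) q) = sum_i Ai v (x) ei q. *)
Record qop := mkO { o0 : X -> X; o1 : X -> X; o2 : X -> X; o3 : X -> X }.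

Definition oc (A : qop) (i : nat) : X -> X :=
  match i with O => o0 A | 1%nat => o1 A | 2%nat => o2 A | _ => o3 A end.

Definition qop_bounded (A : qop) : Prop :=
  is_bop (o0 A) /\ is_bop (o1 A) /\ is_bop (o2 A) /\ is_bop (o3 A).

Definition qop_eq (A B : qop) : Prop :=
  forall x, o0 A x = o0 B x /\ o1 A x = o1 B x /\ o2 A x = o2 B x /\ o3 A x = o3 B x.

Definition qop_zero : qop := mkO fzero fzero fzero fzero.
Definition qop_one : qop := mkO fid fzero fzero fzero.
Definition qop_add (A B : qop) : qop :=
  mkO (fadd (o0 A) (o0 B)) (fadd (o1 A) (o1 B)) (fadd (o2 A) (o2 B)) (fadd (o3 A) (o3 B)).
Definition qop_sub (A B : qop) : qop :=
  mkO (fsub (o0 A) (o0 B)) (fsub (o1 A) (o1 B)) (fsub (o2 A) (o2 B)) (fsub (o3 A) (o3 B)).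
(* composition, following the quaternion multiplication table *)
Definition qop_mul (A B : qop) : qop :=
  mkO (fsub (fsub (fsub (fcomp (o0 A) (o0 B)) (fcomp (o1 A) (o1 B)))
                 (fcomp (o2 A) (o2 B))) (fcomp (o3 A) (o3 B)))
      (fsub (fadd (fadd (fcomp (o0 A) (o1 B)) (fcomp (o1 A) (o0 B)))
                 (fcomp (o2 A) (o3 B))) (fcomp (o3 A) (o2 B)))
      (fadd (fadd (fsub (fcomp (o0 A) (o2 B)) (fcomp (o1 A) (o3 B)))
                 (fcomp (o2 A) (o0 B))) (fcomp (o3 A) (o1 B)))
      (fadd (fsub (fadd (fcomp (o0 A) (o3 B)) (fcomp (o1 A) (o2 B)))
                 (fcomp (o2 A) (o1 B))) (fcomp (o3 A) (o0 B))).
Fixpoint qop_pow (A : qop) (n : nat) : qop :=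
  match n with O => qop_one | S k => qop_mul A (qop_pow A k) end.

(* left multiplication by the quaternion q, as an operator *)
Definition qconst (q : quat) : qop :=
  mkO (fscal (q0 q) fid) (fscal (q1 q) fid) (fscal (q2 q) fid) (fscal (q3 q) fid).

Definition in_BC (T : qop) : Prop :=
  qop_bounded T /\
  forall i j : nat, (i < 4)%nat -> (j < 4)%nat ->
    forall x, oc T i (oc T j x) = oc T j (oc T i x).

Definition qop_conj (T : qop) : qop := mkO (o0 T) (fopp (o1 T)) (fopp (o2 T)) (fopp (o3 T)).

Definition Qcs (T : qop) (s : quat) : qop :=
  qop_add (qop_sub (qconst (qmul s s)) (qop_mul (qconst s) (qop_add T (qop_conj T))))
          (qop_mul T (qop_conj T)).

Definition is_bounded_inverse (A B : qop) : Prop :=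
  qop_bounded B /\ qop_eq (qop_mul A B) qop_one /\ qop_eq (qop_mul B A) qop_one.

Definition S_spectrum (T : qop) (s : quat) : Prop :=
  ~ exists B, is_bounded_inverse (Qcs T s) B.

(* Q_{c,s}(T)^{-1} (a chosen bounded inverse; meaningful off the S-spectrum) *)
Definition Qinv (T : qop) (s : quat) : qop :=
  epsilon (inhabits qop_zero) (fun B => is_bounded_inverse (Qcs T s) B).

Fixpoint Hsum (T : qop) (m n : nat) : qop :=
  match n with
  | O => qop_pow T m
  | S k => qop_add (Hsum T m k) (qop_mul (qop_pow T (m - S k)) (qop_pow (qop_conj T) (S k)))
  end.
Definition Hm (T : qop) (m : nat) : qop := Hsum T m m.

End Ops.

Definition qopen (U : quat -> Prop) : Prop :=
  forall q, U q -> exists eps, 0 < eps /\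
    forall p, qnorm2 (qadd p (qopp q)) < eps ^ 2 -> U p.

Definition qbounded (U : quat -> Prop) : Prop :=
  exists M, forall q, U q -> qnorm2 q <= M.

Definition axially_symmetric (U : quat -> Prop) : Prop :=
  forall (z : R * R) I J, in_S I -> in_S J -> U (emb I z) -> U (emb J z).

Definition d2 (z w : R * R) : R := (fst z - fst w) ^ 2 + (snd z - snd w) ^ 2.
Definition cx (g : R -> R * R) (t : R) : R := fst (g t).
Definition cy (g : R -> R * R) (t : R) : R := snd (g t).

Definition cont_on {V : UniformSpace} (f : R -> V) (a b : R) : Prop :=
  forall t, a <= t <= b ->
    filterlim f (within (fun s => a <= s <= b) (locally t)) (locally (f t)).

Definition pw_C1 (g : R -> R * R) : Prop :=
  exists (n : nat) (p : nat -> R),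
    p O = 0 /\ p n = 1 /\ (forall k, (k < n)%nat -> p k < p (S k)) /\
    forall k, (k < n)%nat ->
      exists d : R -> R * R, cont_on d (p k) (p (S k)) /\
        forall t, p k < t < p (S k) ->
          is_derive (cx g) t (fst (d t)) /\ is_derive (cy g) t (snd (d t)).

Definition jordan_curve (g : R -> R * R) : Prop :=
  cont_on g 0 1 /\ g 0 = g 1 /\
  (forall s t, 0 <= s -> s < t -> t < 1 -> g s <> g t) /\ pw_C1 g.

Definition slice_boundary (J : quat) (U : quat -> Prop) (z : R * R) : Prop :=
  forall eps, 0 < eps ->
    (exists w, d2 w z < eps ^ 2 /\ U (emb J w)) /\
    (exists w, d2 w z < eps ^ 2 /\ ~ U (emb J w)).

Definition curve0 : R -> R * R := fun _ => (0, 0).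

Definition jordan_boundary (J : quat) (U : quat -> Prop) (gs : list (R -> R * R)) : Prop :=
  List.Forall jordan_curve gs /\
  (forall i j, (i < length gs)%nat -> (j < length gs)%nat -> i <> j ->
     forall s t, 0 <= s <= 1 -> 0 <= t <= 1 -> nth i gs curve0 s <> nth j gs curve0 t) /\
  (forall z, slice_boundary J U z <->
     exists g, In g gs /\ exists t, 0 <= t <= 1 /\ g t = z).

Definition wind (g : R -> R * R) (w : R * R) : R :=
  / (2 * PI) * RInt (fun t =>
     ((cx g t - fst w) * Derive (cy g) t - (cy g t - snd w) * Derive (cx g) t)
       / ((cx g t - fst w) ^ 2 + (cy g t - snd w) ^ 2)) 0 1.

Definition pos_oriented (J : quat) (U : quat -> Prop) (gs : list (R -> R * R)) : Prop :=
  forall w,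
    (U (emb J w) -> fold_right (fun g acc => wind g w + acc) 0 gs = 1) /\
    ((exists eps, 0 < eps /\ forall z, d2 z w < eps ^ 2 -> ~ U (emb J z)) ->
       fold_right (fun g acc => wind g w + acc) 0 gs = 0).

Definition slice_cauchy_domain (U : quat -> Prop) : Prop :=
  qopen U /\ axially_symmetric U /\
  forall J, in_S J -> exists gs, jordan_boundary J U gs.

(* i-th component, applied to x, of the integrand
   Q_{c,s}(T)^{-1} ds_J s^{m+1} along g, with s = g(t) in C_J, ds_J = ds (-J) *)
Definition integrand (X : CompleteNormedModule R_AbsRing) (T : qop X) (m : nat)
    (J : quat) (g : R -> R * R) (i : nat) (x : X) (t : R) : X :=
  let s := emb J (g t) in
  let ds := emb J (Derive (cx g) t, Derive (cy g) t) in
  oc (qop_mul (Qinv T s) (qconst X (qmul (qmul ds (qopp J)) (qpow s (S m))))) i x.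

(* Main.v *)
(** Let [V] be [X (x) H], made a complex Banach space by left multiplication by [J].  There
    [Q_{c,s}(T)] is the quadratic pencil [Q_s = s^2 - s A + N] with [A = T + Tbar] and
    [N = T Tbar], both acting complex-linearly.  Put [f(s) = Q_s^{-1} x] and
    [I_k = \oint s^k f(s) ds].  For [w] in [U], the identity
    [Q_w - Q_s = (w - s)(w + s - A)] and the winding number [1] of the boundary give
    [Q_w \oint f(s)/(s - w) ds = p(w)] with [p(w) = 2 pi i x - (w - A) I_0 - I_1].  Off [U]
    the pencil is invertible and [Q_w^{-1} p(w)] solves the same equation.  Since [Q_w] is
    bounded below near every point off [U], both definitions glue to an entire function that
    tends to [0] at infinity, hence vanishes (Dixon's argument); thus [p = 0], that is
    [I_0 = 0] and [I_1 = 2 pi i x].  Integrating [s^k Q_s f(s) = s^k x] yields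
    [I_{k+2} = A I_{k+1} - N I_k], the recurrence that [H_m(T)] satisfies as well.

    Liouville's theorem is proved without integration: the averages of the function over the
    [n]-th roots of unity on circles of radius [r] vary by [O(1/n)] with [r]. *)

(* The familiar route, a Neumann series near infinity followed by a deformation of the contour,
   would need Cauchy's theorem for the region between the boundary curves and a large circle. Here
   the curves are known only through their winding numbers, so the only integrals evaluated in
   closed form are those of [s^k], [1 / (s - w)] and [1 / (s - w)^2].

   Left multiplication by [J] need not commute with [T], so [T] need not be complex-linear. Because
   the components commute, [A = 2 T0] and [N = T0^2 + T1^2 + T2^2 + T3^2] have real coefficients and
   do commute with [J]. The analysis therefore sees [A] and [N] alone; [T] comes back only through
   the recurrence.

   Next to a boundary point the Cauchy integral describes the solution on one side only. What holds
   on both sides is the equation [Q_w h(w) = p(w)], its derivative in [w] and the lower bound for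
   [Q_w]; these suffice for a second-order Taylor estimate across the boundary. Since [p] is affine
   in [w], its vanishing gives both moments at once. *)
Require Import Defs.
From Stdlib Require Import Reals Lra Lia List Classical ClassicalEpsilon Ring.
From Stdlib Require ssreflect.
From Coquelicot Require Import Coquelicot.
Open Scope R_scope.

(** * Integration of functions continuous on a closed interval *)

Lemma Riemann_sum_linear {U V : NormedModule R_AbsRing} (l : U -> V) (f : R -> U)
    (ptd : SF_seq) :
  is_linear l -> Riemann_sum (fun t => l (f t)) ptd = l (Riemann_sum f ptd).
Proof.
  intros Hl; induction ptd using SF_cons_ind.
  - unfold Riemann_sum; simpl. symmetry.
    rewrite <- (scal_zero_l (K := R_Ring) (zero : U)), (linear_scal l Hl).
    apply (scal_zero_l (K := R_Ring)).
  - rewrite !Riemann_sum_cons, IHptd, (linear_plus l Hl), (linear_scal l Hl); reflexivity.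
Qed.

(** A continuous linear map commutes with Riemann sums, hence with their limit. This is how
    operators, scalars and coordinate projections pass through the integrals below. *)
Lemma is_RInt_linear {U V : NormedModule R_AbsRing} (l : U -> V) (f : R -> U)
    (a b : R) (v : U) :
  is_linear l -> is_RInt f a b v -> is_RInt (fun t => l (f t)) a b (l v).
Proof.
  intros Hl Hf. unfold is_RInt in *.
  apply filterlim_ext with
    (fun ptd => l (scal (sign (b - a)) (Riemann_sum f ptd))).
  - intros ptd. rewrite (linear_scal l Hl), (Riemann_sum_linear l f) by exact Hl. reflexivity.
  - eapply filterlim_comp; [exact Hf | apply (linear_cont l v Hl)].
Qed.

(** For [a <= b], the retraction of the line onto [[a, b]]. Precomposing with it turns continuity
    relative to the interval into continuity everywhere. *)
Definition clamp (a b t : R) : R := Rmax a (Rmin b t).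

Lemma clamp_bounds (a b t : R) : a <= b -> a <= clamp a b t <= b.
Proof. intros H; unfold clamp, Rmax, Rmin; repeat destruct Rle_dec; lra. Qed.

Lemma clamp_id (a b t : R) : a <= t <= b -> clamp a b t = t.
Proof. intros H; unfold clamp, Rmax, Rmin; repeat destruct Rle_dec; lra. Qed.

Lemma clamp_lipschitz (a b s t : R) : Rabs (clamp a b s - clamp a b t) <= Rabs (s - t).
Proof.
  unfold clamp, Rmax, Rmin; repeat destruct Rle_dec; unfold Rabs;
    repeat destruct Rcase_abs; lra.
Qed.

Lemma cont_on_clamp {V : UniformSpace} (f : R -> V) (a b : R) :
  a <= b -> cont_on f a b -> forall t, continuous (fun s => f (clamp a b s)) t.
Proof.
  intros Hab Hf t.
  apply (filterlim_comp _ _ _ (clamp a b) f (locally t)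
           (within (fun s => a <= s <= b) (locally (clamp a b t)))).
  2: apply Hf, clamp_bounds, Hab.
  intros P [d Hd]. exists d. intros s Hs. apply Hd.
  - eapply Rle_lt_trans; [apply clamp_lipschitz | exact Hs].
  - apply clamp_bounds, Hab.
Qed.

Lemma cont_on_continuous {V : UniformSpace} (f : R -> V) (a b : R) :
  (forall t, a <= t <= b -> continuous f t) -> cont_on f a b.
Proof.
  intros H t Ht. eapply filterlim_filter_le_1; [|apply (H t Ht)].
  apply filter_le_within.
Qed.

Lemma cont_on_ext {V : UniformSpace} (f g : R -> V) (a b : R) :
  (forall t, a <= t <= b -> f t = g t) -> cont_on f a b -> cont_on g a b.
Proof.
  intros E H t Ht. rewrite <- E by exact Ht.
  eapply filterlim_within_ext; [|apply (H t Ht)]. intros; apply E; assumption.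
Qed.

Lemma cont_on_sub {V : UniformSpace} (f : R -> V) (a b c d : R) :
  a <= c -> d <= b -> cont_on f a b -> cont_on f c d.
Proof.
  intros Hc Hd H t Ht. eapply filterlim_filter_le_1; [|apply (H t); lra].
  intros P [e He]. exists e. intros y Hy Hy'. apply He; [exact Hy | lra].
Qed.

Lemma cont_on_of_clamp {V : UniformSpace} (f : R -> V) (a b : R) :
  (forall t, continuous (fun s => f (clamp a b s)) t) -> cont_on f a b.
Proof.
  intros H. apply (cont_on_ext (fun s => f (clamp a b s))).
  - intros t Ht. rewrite clamp_id; auto.
  - apply cont_on_continuous; auto.
Qed.

Lemma cont_on_comp {U V : UniformSpace} (f : R -> U) (l : U -> V) (a b : R) :
  cont_on f a b -> (forall t, a <= t <= b -> continuous l (f t)) ->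
  cont_on (fun t => l (f t)) a b.
Proof.
  intros Hf Hl t Ht. eapply filterlim_comp; [apply (Hf t Ht) | apply (Hl t Ht)].
Qed.

Lemma cont_on_scal {V : NormedModule R_AbsRing} (k : R -> R) (f : R -> V) (a b : R) :
  a <= b -> cont_on k a b -> cont_on f a b -> cont_on (fun t => scal (k t) (f t)) a b.
Proof.
  intros Hab Hk Hf. apply cont_on_of_clamp; intros t.
  apply (continuous_scal (K := R_AbsRing) (fun s => k (clamp a b s)));
    [apply (cont_on_clamp k) | apply cont_on_clamp]; assumption.
Qed.

Lemma cont_on_plus {V : NormedModule R_AbsRing} (f g : R -> V) (a b : R) :
  a <= b -> cont_on f a b -> cont_on g a b -> cont_on (fun t => plus (f t) (g t)) a b.
Proof.
  intros Hab Hk Hf. apply cont_on_of_clamp; intros t.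
  apply (continuous_plus (fun s => f (clamp a b s)) (fun s => g (clamp a b s)));
    apply cont_on_clamp; assumption.
Qed.

Lemma cont_on_lipschitz {V : NormedModule R_AbsRing} (g : R -> C) (f : R -> V) (a b : R) :
  cont_on g a b ->
  (forall t, a <= t <= b -> exists d K, 0 < d /\ forall s, a <= s <= b ->
     Cmod (g s - g t) < d -> norm (minus (f s) (f t)) <= K * Cmod (g s - g t)) ->
  cont_on f a b.
Proof.
  intros Hg Hf t Ht. destruct (Hf t Ht) as (d & K & Hd & HK).
  intros P [e He].
  assert (He' : 0 < Rmin d (e / (1 + Rabs K))).
  { apply Rmin_pos; [exact Hd|]. apply Rdiv_lt_0_compat; [apply cond_pos|].
    generalize (Rabs_pos K); lra. }
  (* A ball of [C] is a square in the coordinates. The square of half the wanted radius fits into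
     the disc because [sqrt 2 / 2 <= 1]. *)
  assert (Hloc : locally (g t) (fun z : C => Cmod (z - g t) < Rmin d (e / (1 + Rabs K)))).
  { exists (mkposreal (Rmin d (e / (1 + Rabs K)) / 2) ltac:(lra)).
    intros z Hz. apply (C_NormedModule_mixin_compat2 (g t) z) in Hz. simpl in Hz.
    eapply Rlt_le_trans; [exact Hz|].
    assert (sqrt 2 <= 2).
    { rewrite <- (sqrt_square 2) at 2 by lra. apply sqrt_le_1; lra. }
    nra. }
  destruct (Hg t Ht _ Hloc) as [r Hr].
  exists r. intros s Hs Hs'. apply He, norm_compat1.
  specialize (Hr s Hs Hs'); simpl in Hr.
  apply Rmin_Rgt in Hr; destruct Hr as [Hr1 Hr2].
  eapply Rle_lt_trans; [apply HK; [exact Hs' | exact Hr1]|].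
  apply (Rle_lt_trans _ ((1 + Rabs K) * Cmod (g s - g t))).
  - apply Rmult_le_compat_r; [apply Cmod_ge_0|]. generalize (Rle_abs K); lra.
  - assert (0 < 1 + Rabs K) by (generalize (Rabs_pos K); lra).
    apply (Rmult_lt_compat_l (1 + Rabs K)) in Hr2; [|assumption].
    eapply Rlt_le_trans; [exact Hr2|]. right; field; lra.
Qed.

Lemma ex_RInt_cont_on {V : CompleteNormedModule R_AbsRing} (f : R -> V) (a b : R) :
  a <= b -> cont_on f a b -> ex_RInt f a b.
Proof.
  intros Hab Hf. apply (ex_RInt_ext (fun s => f (clamp a b s))).
  - rewrite Rmin_left, Rmax_right by exact Hab.
    intros t Ht; rewrite clamp_id; [reflexivity | lra].
  - apply (ex_RInt_continuous (V := V)). intros; apply cont_on_clamp; assumption.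
Qed.

Lemma cont_on_bounded {V : NormedModule R_AbsRing} (f : R -> V) (a b : R) :
  a <= b -> cont_on f a b -> exists M, 0 <= M /\ forall t, a <= t <= b -> norm (f t) <= M.
Proof.
  intros Hab Hf.
  destruct (continuity_ab_maj (fun t => norm (f (clamp a b t))) a b Hab) as (s & Hs & _).
  - intros c _. apply continuity_pt_filterlim.
    apply (continuous_comp (fun t => f (clamp a b t)) norm).
    + apply cont_on_clamp; assumption.
    + apply (filterlim_norm (f (clamp a b c))).
  - exists (norm (f (clamp a b s))). split; [apply norm_ge_0|].
    intros t Ht. specialize (Hs t Ht). simpl in Hs. rewrite (clamp_id a b t) in Hs; assumption.
Qed.

(** At a corner of a curve the derivative may not exist, so it is assumed on the open interval
    alone. The primitive [F] of the clamped [d] differs from [f] by a continuous function with zero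
    derivative inside, and the mean value theorem makes that difference constant. *)
Lemma is_RInt_derive_open (f d : R -> R) (a b : R) :
  a <= b -> cont_on f a b -> cont_on d a b ->
  (forall t, a < t < b -> is_derive f t (d t)) -> is_RInt d a b (f b - f a).
Proof.
  intros Hab Hf Hd Hfd.
  set (D := fun t => d (clamp a b t)).
  assert (HD : forall t, continuous D t) by (intros; apply (cont_on_clamp d); assumption).
  set (F := fun t => RInt D a t).
  assert (HF : forall t, is_derive F t (D t)).
  { intros t. apply (is_derive_RInt (V := R_CompleteNormedModule) D F a t); [|apply HD].
    exists (mkposreal 1 Rlt_0_1). intros y _. apply (RInt_correct (V := R_CompleteNormedModule)).
    apply (ex_RInt_continuous (V := R_CompleteNormedModule)); intros; apply HD. }
  assert (E : F b = f b - f a).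
  { destruct (MVT_gen (fun t => F t - f (clamp a b t)) a b (fun _ => 0)) as (c & _ & Hc).
    - rewrite Rmin_left, Rmax_right by exact Hab. intros t Ht.
      apply (is_derive_ext_loc (fun t => F t - f t)).
      + exists (mkposreal (Rmin (t - a) (b - t)) ltac:(apply Rmin_pos; lra)).
        intros y Hy. change (Rabs (y - t) < Rmin (t - a) (b - t)) in Hy.
        apply Rmin_Rgt in Hy; destruct Hy as [Hy1 Hy2].
        unfold Rgt in *. apply Rabs_def2 in Hy1. apply Rabs_def2 in Hy2.
        rewrite clamp_id; [reflexivity | lra].
      + replace 0 with (D t - d t) by (unfold D; rewrite clamp_id; lra).
        apply (is_derive_minus (K := R_AbsRing) (V := R_NormedModule) F f); auto.
    - intros t _. apply continuity_pt_filterlim.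
      apply (continuous_minus (K := R_AbsRing) (V := R_NormedModule) F (fun s => f (clamp a b s))).
      + apply (ex_derive_continuous F). eexists; apply HF.
      + apply (cont_on_clamp f); assumption.
    - simpl in Hc. rewrite !clamp_id in Hc by lra.
      assert (F a = 0) by apply (RInt_point (V := R_CompleteNormedModule)). lra. }
  rewrite <- E. apply (is_RInt_ext D).
  - rewrite Rmin_left, Rmax_right by exact Hab.
    intros t Ht; unfold D; rewrite clamp_id; [reflexivity | lra].
  - apply (RInt_correct (V := R_CompleteNormedModule)).
    apply (ex_RInt_continuous (V := R_CompleteNormedModule)); intros; apply HD.
Qed.

(** * Piecewise continuously differentiable curves *)

(** Induction along the subdivision: whatever is additive in the interval need be checked only on
    one continuously differentiable piece, with [P 0 0] as the start. *)
Lemma pw_C1_ind (g : R -> R * R) (P : R -> R -> Prop) :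
  pw_C1 g -> P 0 0 ->
  (forall a b c, P a b -> P b c -> P a c) ->
  (forall a b d, 0 <= a -> a < b -> b <= 1 -> cont_on d a b ->
     (forall t, a < t < b -> is_derive (cx g) t (fst (d t)) /\ is_derive (cy g) t (snd (d t))) ->
     P a b) ->
  P 0 1.
Proof.
  intros (n & p & p0 & pn & pinc & Hd) P0 Ptr Ppiece.
  assert (Hmono : forall i k, (i + k <= n)%nat -> p i <= p (i + k)%nat).
  { intros i k; induction k; intros Hk.
    - rewrite Nat.add_0_r; lra.
    - rewrite Nat.add_succ_r in *. specialize (pinc (i + k)%nat ltac:(lia)).
      specialize (IHk ltac:(lia)). lra. }
  assert (H : forall k, (k <= n)%nat -> P 0 (p k)).
  { induction k; intros Hk; [rewrite p0; exact P0|].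
    apply (Ptr _ (p k)); [apply IHk; lia|].
    destruct (Hd k ltac:(lia)) as (d & Hdc & Hdd).
    apply (Ppiece _ _ d); auto.
    - rewrite <- p0. apply (Hmono 0%nat k); lia.
    - rewrite <- pn. replace n with (S k + (n - S k))%nat by lia. apply Hmono; lia. }
  rewrite <- pn. apply H; lia.
Qed.

Definition velocity (g : R -> R * R) (t : R) : C := (Derive (cx g) t, Derive (cy g) t).

Lemma velocity_bounded (g : R -> R * R) :
  pw_C1 g -> exists L, 0 <= L /\ forall t, 0 <= t <= 1 -> Cmod (velocity g t) <= L.
Proof.
  intros Hg.
  apply (pw_C1_ind g (fun a b => exists L, 0 <= L /\
           forall t, a <= t <= b -> Cmod (velocity g t) <= L) Hg).
  - exists (Cmod (velocity g 0)). split; [apply Cmod_ge_0|].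
    intros t Ht. replace t with 0 by lra. lra.
  - intros a b c (L & HL & H) (L' & HL' & H').
    exists (Rmax L L'). split; [apply (Rle_trans _ L); [lra | apply Rmax_l]|].
    intros t Ht. destruct (Rle_dec t b).
    + apply (Rle_trans _ L); [apply H; lra | apply Rmax_l].
    + apply (Rle_trans _ L'); [apply H'; lra | apply Rmax_r].
  - intros a b d Ha Hab Hb Hd Hdd.
    destruct (cont_on_bounded (V := C_R_NormedModule) d a b ltac:(lra) Hd) as (M & HM & HdM).
    (* At the two ends of a piece [Derive] need not agree with [d], so its values there enter the
       bound separately. *)
    exists (M + Cmod (velocity g a) + Cmod (velocity g b)).
    generalize (Cmod_ge_0 (velocity g a)) (Cmod_ge_0 (velocity g b)); intros Hva Hvb.
    split; [lra|]. intros t Ht.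
    destruct (Req_dec t a) as [->|Hta]; [lra|]. destruct (Req_dec t b) as [->|Htb]; [lra|].
    assert (Cmod (velocity g t) <= M); [|lra].
    destruct (Hdd t ltac:(lra)) as [H1 H2]. unfold velocity.
    rewrite (is_derive_unique _ _ _ H1), (is_derive_unique _ _ _ H2), <- surjective_pairing.
    rewrite Cmod_norm. apply HdM; lra.
Qed.

(** Inside each piece the velocity agrees with the continuous [d], and the values at the end points
    do not affect integrability. *)
Lemma ex_RInt_velocity {V : CompleteNormedModule R_AbsRing} (g : R -> R * R) (y z : R -> V) :
  pw_C1 g -> cont_on y 0 1 -> cont_on z 0 1 ->
  ex_RInt (fun t => plus (scal (Derive (cx g) t) (y t)) (scal (Derive (cy g) t) (z t))) 0 1.
Proof.
  intros Hg Hy Hz. apply (pw_C1_ind g (fun a b => ex_RInt _ a b) Hg).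
  - apply ex_RInt_point.
  - intros a b c; apply ex_RInt_Chasles.
  - intros a b d Ha Hab Hb Hd Hdd.
    apply (ex_RInt_ext (fun t => plus (scal (fst (d t)) (y t)) (scal (snd (d t)) (z t)))).
    + rewrite Rmin_left, Rmax_right by lra. intros t Ht. destruct (Hdd t Ht) as [H1 H2].
      rewrite (is_derive_unique _ _ _ H1), (is_derive_unique _ _ _ H2); reflexivity.
    + apply ex_RInt_cont_on; [lra|].
      apply (cont_on_plus (V := V) (fun t => scal (fst (d t)) (y t))
               (fun t => scal (snd (d t)) (z t))); [lra| |];
        apply (cont_on_scal (V := V)); try lra.
      * apply (cont_on_comp d fst); [exact Hd|]. intros; apply continuous_fst.
      * apply (cont_on_sub y 0 1); assumption.
      * apply (cont_on_comp d snd); [exact Hd|]. intros; apply continuous_snd.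
      * apply (cont_on_sub z 0 1); assumption.
Qed.

(** The fundamental theorem for the one-form [u dx + v dy] along [g]. The chain rule for [f] is
    demanded only at parameters where [g] is differentiable. *)
Lemma is_RInt_exact (g : R -> R * R) (f u v : R -> R) :
  pw_C1 g -> cont_on f 0 1 -> cont_on u 0 1 -> cont_on v 0 1 ->
  (forall t dx dy, 0 <= t <= 1 -> is_derive (cx g) t dx -> is_derive (cy g) t dy ->
     is_derive f t (u t * dx + v t * dy)) ->
  is_RInt (fun t => u t * Derive (cx g) t + v t * Derive (cy g) t) 0 1 (f 1 - f 0).
Proof.
  intros Hg Hf Hu Hv Hfd.
  apply (pw_C1_ind g (fun a b => is_RInt _ a b (f b - f a)) Hg).
  - rewrite Rminus_diag. apply (is_RInt_point (V := R_NormedModule)).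
  - intros a b c H1 H2.
    replace (f c - f a) with (plus (f b - f a) (f c - f b)) by (unfold plus; simpl; ring).
    apply (is_RInt_Chasles (V := R_NormedModule) _ a b c); assumption.
  - intros a b d Ha Hab Hb Hd Hdd.
    apply (is_RInt_ext (fun t => u t * fst (d t) + v t * snd (d t))).
    + rewrite Rmin_left, Rmax_right by lra. intros t Ht. destruct (Hdd t Ht) as [H1 H2].
      rewrite (is_derive_unique _ _ _ H1), (is_derive_unique _ _ _ H2); reflexivity.
    + apply is_RInt_derive_open; [lra| apply (cont_on_sub f 0 1); assumption | |].
      * apply (cont_on_plus (V := R_NormedModule) (fun t => u t * fst (d t))
                 (fun t => v t * snd (d t))); [lra| |].
        -- apply (cont_on_scal (V := R_NormedModule) u (fun t => fst (d t))); [lra| |].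
           ++ apply (cont_on_sub u 0 1); assumption.
           ++ apply (cont_on_comp d fst); [exact Hd|]. intros; apply continuous_fst.
        -- apply (cont_on_scal (V := R_NormedModule) v (fun t => snd (d t))); [lra| |].
           ++ apply (cont_on_sub v 0 1); assumption.
           ++ apply (cont_on_comp d snd); [exact Hd|]. intros; apply continuous_snd.
      * intros t Ht. destruct (Hdd t Ht). apply Hfd; try assumption; lra.
Qed.

(** * Continuity and derivatives of complex functions of a real parameter *)

Lemma cont_on_const {V : UniformSpace} (v : V) (a b : R) : cont_on (fun _ => v) a b.
Proof. apply cont_on_continuous; intros; apply continuous_const. Qed.

Lemma cont_on_Rmult (u v : R -> R) (a b : R) :
  a <= b -> cont_on u a b -> cont_on v a b -> cont_on (fun t => u t * v t) a b.
Proof. apply (cont_on_scal (V := R_NormedModule)). Qed.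

Lemma cont_on_Rplus (u v : R -> R) (a b : R) :
  a <= b -> cont_on u a b -> cont_on v a b -> cont_on (fun t => u t + v t) a b.
Proof. apply (cont_on_plus (V := R_NormedModule)). Qed.

Lemma cont_on_sqr (u : R -> R) (a b : R) :
  a <= b -> cont_on u a b -> cont_on (fun t => u t ^ 2) a b.
Proof.
  intros Hab Hu. apply (cont_on_Rmult u (fun t => u t * 1)); [exact Hab | exact Hu |].
  apply (cont_on_Rmult u (fun _ => 1)); [exact Hab | exact Hu |].
  apply (cont_on_const (V := R_UniformSpace)).
Qed.

Lemma cont_on_Ropp (u : R -> R) (a b : R) :
  cont_on u a b -> cont_on (fun t => - u t) a b.
Proof.
  intros Hu. apply (cont_on_comp u Ropp); [exact Hu|].
  intros t _. apply (filterlim_opp (u t)).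
Qed.

Lemma cont_on_Rinv (u : R -> R) (a b : R) :
  cont_on u a b -> (forall t, a <= t <= b -> u t <> 0) -> cont_on (fun t => / u t) a b.
Proof.
  intros Hu H0. apply (cont_on_comp u Rinv); [exact Hu|].
  intros t Ht. apply continuity_pt_filterlim, (continuity_pt_inv id).
  - apply continuity_pt_id.
  - apply (H0 t Ht).
Qed.

Definition ccont (phi : R -> C) : Prop :=
  cont_on (fun t => fst (phi t)) 0 1 /\ cont_on (fun t => snd (phi t)) 0 1.

Lemma ccont_cont_on (phi : R -> C) : cont_on phi 0 1 -> ccont phi.
Proof.
  intros H; split.
  - apply (cont_on_comp phi fst); [exact H|]. intros; apply continuous_fst.
  - apply (cont_on_comp phi snd); [exact H|]. intros; apply continuous_snd.
Qed.

Lemma ccont_const (c : C) : ccont (fun _ => c).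
Proof. split; apply (cont_on_const (V := R_UniformSpace)). Qed.

Lemma ccont_plus (phi psi : R -> C) :
  ccont phi -> ccont psi -> ccont (fun t => Cplus (phi t) (psi t)).
Proof. intros [H1 H2] [H3 H4]; split; apply cont_on_Rplus; assumption || lra. Qed.

Lemma ccont_mult (phi psi : R -> C) :
  ccont phi -> ccont psi -> ccont (fun t => Cmult (phi t) (psi t)).
Proof.
  intros [H1 H2] [H3 H4].
  assert (Hm : forall u v : R -> R, cont_on u 0 1 -> cont_on v 0 1 ->
    cont_on (fun t => u t * v t) 0 1) by (intros; apply cont_on_Rmult; assumption || lra).
  split.
  - apply (cont_on_Rplus (fun t => fst (phi t) * fst (psi t))
             (fun t => - (snd (phi t) * snd (psi t)))); [lra | apply Hm; assumption |].
    apply (cont_on_Ropp (fun t => snd (phi t) * snd (psi t))), Hm; assumption.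
  - apply (cont_on_Rplus (fun t => fst (phi t) * snd (psi t))
             (fun t => snd (phi t) * fst (psi t))); [lra | |]; apply Hm; assumption.
Qed.

Lemma ccont_pow (phi : R -> C) (n : nat) :
  ccont phi -> ccont (fun t => (phi t ^ n)%C).
Proof.
  intros H; induction n; simpl; [apply ccont_const | apply ccont_mult; assumption].
Qed.

Lemma Cnorm2_neq0 (z : C) : z <> 0 -> fst z ^ 2 + snd z ^ 2 <> 0.
Proof.
  intros Hz H. apply Hz. apply Cmod_eq_0. unfold Cmod. rewrite H. apply sqrt_0.
Qed.

Lemma ccont_inv (phi : R -> C) :
  (forall t, 0 <= t <= 1 -> phi t <> 0) -> ccont phi -> ccont (fun t => Cinv (phi t)).
Proof.
  intros H0 [H1 H2].
  assert (Hn : cont_on (fun t => / (fst (phi t) ^ 2 + snd (phi t) ^ 2)) 0 1).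
  { apply (cont_on_Rinv (fun t => fst (phi t) ^ 2 + snd (phi t) ^ 2)).
    - apply cont_on_Rplus; [lra | |]; apply cont_on_sqr; lra || assumption.
    - intros t Ht; apply Cnorm2_neq0, H0, Ht. }
  split; unfold Cinv; cbn [fst snd]; apply cont_on_Rmult; try assumption; try lra.
  apply cont_on_Ropp; assumption.
Qed.

Definition is_cderive (phi : R -> C) (t : R) (d : C) : Prop :=
  is_derive (fun s => fst (phi s)) t (fst d) /\ is_derive (fun s => snd (phi s)) t (snd d).

Lemma is_cderive_const (c : C) (t : R) : is_cderive (fun _ => c) t 0.
Proof. split; exact (is_derive_const (K := R_AbsRing) (V := R_NormedModule) _ t). Qed.

Lemma is_cderive_plus (phi psi : R -> C) (t : R) (d e : C) :
  is_cderive phi t d -> is_cderive psi t e ->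
  is_cderive (fun s => Cplus (phi s) (psi s)) t (Cplus d e).
Proof.
  intros [H1 H2] [H3 H4]; split.
  - apply (is_derive_plus (K := R_AbsRing) (V := R_NormedModule) _ _ t _ _ H1 H3).
  - apply (is_derive_plus (K := R_AbsRing) (V := R_NormedModule) _ _ t _ _ H2 H4).
Qed.

Lemma is_cderive_mult (phi psi : R -> C) (t : R) (d e : C) :
  is_cderive phi t d -> is_cderive psi t e ->
  is_cderive (fun s => Cmult (phi s) (psi s)) t (Cplus (Cmult d (psi t)) (Cmult (phi t) e)).
Proof.
  intros [H1 H2] [H3 H4]; split; cbn [fst snd Cmult Cplus].
  - evar_last.
    + apply (is_derive_minus (K := R_AbsRing) (V := R_NormedModule)
               (fun s => fst (phi s) * fst (psi s)) (fun s => snd (phi s) * snd (psi s)));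
        apply (is_derive_mult (K := R_AbsRing)); eassumption || (intros; apply Rmult_comm).
    + unfold minus, plus, opp, mult; simpl; ring.
  - evar_last.
    + apply (is_derive_plus (K := R_AbsRing) (V := R_NormedModule)
               (fun s => fst (phi s) * snd (psi s)) (fun s => snd (phi s) * fst (psi s)));
        apply (is_derive_mult (K := R_AbsRing)); eassumption || (intros; apply Rmult_comm).
    + unfold plus, mult; simpl; ring.
Qed.

Lemma is_cderive_pow (phi : R -> C) (n : nat) (t : R) (d : C) :
  is_cderive phi t d ->
  is_cderive (fun s => (phi s ^ S n)%C) t (Cmult (Cmult (INR (S n)) (phi t ^ n)) d).
Proof.
  intros H; induction n.
  - eapply eq_ind; [apply (is_cderive_mult _ _ t _ _ H (is_cderive_const 1 t))|].
    simpl. ring.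
  - eapply eq_ind; [apply (is_cderive_mult _ _ t _ _ H IHn)|].
    rewrite (S_INR (S n)), RtoC_plus. simpl (Cpow _ (S n)). ring.
Qed.

Lemma is_cderive_inv (phi : R -> C) (t : R) (d : C) :
  phi t <> 0 -> is_cderive phi t d ->
  is_cderive (fun s => Cinv (phi s)) t (Copp (Cmult (Cmult (Cinv (phi t)) (Cinv (phi t))) d)).
Proof.
  intros H0 [H1 H2]. apply Cnorm2_neq0 in H0.
  assert (Hn : is_derive (fun s => fst (phi s) ^ 2 + snd (phi s) ^ 2) t
                 (2 * fst (phi t) * fst d + 2 * snd (phi t) * snd d)).
  { evar_last.
    - apply (is_derive_plus (K := R_AbsRing) (V := R_NormedModule)
               (fun s => fst (phi s) ^ 2) (fun s => snd (phi s) ^ 2));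
        apply is_derive_pow; eassumption.
    - unfold plus; simpl; ring. }
  split; cbn [fst snd Cmult Copp Cinv].
  - evar_last.
    + apply is_derive_div; eassumption.
    + simpl. field. simpl in H0; lra.
  - evar_last.
    + apply (is_derive_div (fun s => - snd (phi s))); try eassumption.
      apply (is_derive_opp (K := R_AbsRing) (V := R_NormedModule)); eassumption.
    + unfold opp; simpl. field. simpl in H0; lra.
Qed.

(** * Complex structures on real Banach spaces and cycle integrals *)

Section ComplexModule.
Variable V : CompleteNormedModule R_AbsRing.
Variable j : V -> V.
Hypothesis j_linear : is_linear j.
Hypothesis j_square : forall v, j (j v) = opp v.

Section Algebra.
Import ssreflect.

Definition cs (c : C) (v : V) : V := plus (scal (fst c) v) (scal (snd c) (j v)).

Lemma cs_plus_r c v w : cs c (plus v w) = plus (cs c v) (cs c w).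
Proof.
  unfold cs. rewrite (linear_plus j j_linear) !scal_distr_l !plus_assoc.
  f_equal. rewrite -!plus_assoc. f_equal. apply plus_comm.
Qed.

Lemma cs_plus_l c d v : cs (Cplus c d) v = plus (cs c v) (cs d v).
Proof.
  unfold cs; simpl.
  change (fst c + fst d) with (plus (fst c) (fst d)).
  change (snd c + snd d) with (plus (snd c) (snd d)).
  rewrite !(scal_distr_r (K := R_Ring)) -!plus_assoc. f_equal.
  rewrite !plus_assoc. f_equal. apply plus_comm.
Qed.

Lemma cs_mult c d v : cs (Cmult c d) v = cs c (cs d v).
Proof.
  unfold cs; simpl.
  rewrite (linear_plus j j_linear) !(linear_scal j j_linear) j_square.
  rewrite !scal_distr_l !(scal_assoc (K := R_Ring)) scal_opp_r -scal_opp_l.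
  unfold Rminus. change Rplus with (@plus R_AbelianGroup).
  change Rmult with (@mult R_Ring). change Ropp with (@opp R_AbelianGroup).
  rewrite !(scal_distr_r (K := R_Ring)) -!plus_assoc. f_equal.
  rewrite plus_comm -!plus_assoc. f_equal.
Qed.

Lemma cs_real r v : cs (RtoC r) v = scal r v.
Proof. unfold cs; simpl. rewrite (scal_zero_l (K := R_Ring)) plus_zero_r; reflexivity. Qed.

Lemma cs_1 v : cs (RtoC 1) v = v.
Proof. rewrite cs_real. apply (scal_one (K := R_Ring)). Qed.

Lemma cs_0 v : cs (RtoC 0) v = zero.
Proof. rewrite cs_real. exact (scal_zero_l (K := R_Ring) (V := V) v). Qed.

Lemma cs_zero_r c : cs c zero = zero.
Proof. rewrite -(cs_0 zero) -cs_mult. f_equal. ring. Qed.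

End Algebra.

(* The square-zero extension [C (+) V] lets [ring] decide identities of [C]-modules. *)
Definition ext : Type := (C * V)%type.
Definition ext_add (p q : ext) : ext := (Cplus (fst p) (fst q), plus (snd p) (snd q)).
Definition ext_opp (p : ext) : ext := (Copp (fst p), opp (snd p)).
Definition ext_sub (p q : ext) : ext := ext_add p (ext_opp q).
Definition ext_mul (p q : ext) : ext :=
  (Cmult (fst p) (fst q), plus (cs (fst p) (snd q)) (cs (fst q) (snd p))).
Definition ext_scalar (c : C) : ext := (c, zero).
Definition ext_vector (v : V) : ext := (RtoC 0, v).

Lemma ext_ring_theory :
  ring_theory (ext_scalar 0) (ext_scalar 1) ext_add ext_mul ext_sub ext_opp eq.
Proof.
  split; intros; unfold ext_sub, ext_add, ext_mul, ext_opp, ext_scalar; simpl;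
    try destruct x as [a x]; try destruct y as [b y]; try destruct z as [c z]; simpl;
    try reflexivity; f_equal; try ring.
  - apply plus_zero_l.
  - apply plus_comm.
  - apply plus_assoc.
  - rewrite cs_zero_r, plus_zero_r. apply cs_1.
  - apply plus_comm.
  - rewrite !cs_plus_r, !cs_mult, !plus_assoc. f_equal.
    + f_equal. rewrite <- !cs_mult. f_equal; ring.
    + rewrite <- !cs_mult. f_equal; ring.
  - rewrite cs_plus_l, cs_plus_r, <- !plus_assoc. f_equal.
    rewrite !plus_assoc. f_equal. apply plus_comm.
  - exact (plus_opp_r (G := V) x).
Qed.

Add Ring ext_ring : ext_ring_theory.

Lemma ext_vector_inj v w : ext_vector v = ext_vector w -> v = w.
Proof. intros H; injection H; auto. Qed.
Lemma ext_vector_plus v w : ext_vector (plus v w) = ext_add (ext_vector v) (ext_vector w).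
Proof. unfold ext_vector, ext_add; simpl; f_equal; ring. Qed.
Lemma ext_vector_opp v : ext_vector (opp v) = ext_opp (ext_vector v).
Proof. unfold ext_vector, ext_opp; simpl; f_equal; ring. Qed.
Lemma ext_vector_minus v w : ext_vector (minus v w) = ext_sub (ext_vector v) (ext_vector w).
Proof. unfold minus, ext_sub. rewrite ext_vector_plus, ext_vector_opp; reflexivity. Qed.
Lemma ext_vector_zero : ext_vector zero = ext_scalar 0.
Proof. reflexivity. Qed.
Lemma ext_vector_cs c v : ext_vector (cs c v) = ext_mul (ext_scalar c) (ext_vector v).
Proof.
  unfold ext_vector, ext_mul, ext_scalar; simpl.
  rewrite cs_0, plus_zero_r; f_equal; ring.
Qed.
Lemma ext_scalar_plus c d : ext_scalar (Cplus c d) = ext_add (ext_scalar c) (ext_scalar d).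
Proof. unfold ext_scalar, ext_add; simpl. rewrite plus_zero_r; reflexivity. Qed.
Lemma ext_scalar_opp c : ext_scalar (Copp c) = ext_opp (ext_scalar c).
Proof. unfold ext_scalar, ext_opp; simpl. f_equal. exact (eq_sym (opp_zero (G := V))). Qed.
Lemma ext_scalar_minus c d : ext_scalar (Cminus c d) = ext_sub (ext_scalar c) (ext_scalar d).
Proof. unfold Cminus, ext_sub. rewrite ext_scalar_plus, ext_scalar_opp; reflexivity. Qed.
Lemma ext_scalar_mult c d : ext_scalar (Cmult c d) = ext_mul (ext_scalar c) (ext_scalar d).
Proof. unfold ext_scalar, ext_mul; simpl. rewrite !cs_zero_r, plus_zero_r; reflexivity. Qed.

Ltac cmodule :=
  apply ext_vector_inj;
  repeat rewrite ?ext_vector_plus, ?ext_vector_minus, ?ext_vector_opp, ?ext_vector_cs,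
    ?ext_vector_zero, ?ext_scalar_plus, ?ext_scalar_opp, ?ext_scalar_minus, ?ext_scalar_mult;
  ring.

(** The norm of [V] is real-homogeneous but need not be complex-homogeneous; [kappa] measures the
    failure. *)
Variable kappa : R.
Hypothesis kappa_pos : 0 < kappa.
Hypothesis norm_cs : forall c v, norm (cs c v) <= kappa * Cmod c * norm v.

(** Apply [norm_cs] to [Cinv c] and the vector [cs c v]. *)
Lemma norm_cs_lower c v : Cmod c * norm v <= kappa * norm (cs c v).
Proof.
  destruct (Ceq_dec c 0) as [->|Hc].
  - rewrite Cmod_0, Rmult_0_l. apply Rmult_le_pos; [lra | apply norm_ge_0].
  - replace v with (cs (Cinv c) (cs c v)) at 1.
    2: { rewrite <- cs_mult, Cinv_l by exact Hc. apply cs_1. }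
    assert (Hc' := proj1 (Cmod_gt_0 c) Hc).
    apply (Rle_trans _ (Cmod c * (kappa * Cmod (Cinv c) * norm (cs c v)))).
    + apply Rmult_le_compat_l; [lra | apply norm_cs].
    + right. rewrite Cmod_inv by exact Hc. field. lra.
Qed.

Lemma normV_zero : norm (zero : V) = 0.
Proof. exact (norm_zero (V := V)). Qed.

Lemma normV_plus (v w : V) : norm (plus v w) <= norm v + norm w.
Proof. exact (norm_triangle (V := V) v w). Qed.

Lemma normV_opp (v : V) : norm (opp v) = norm v.
Proof. exact (norm_opp (V := V) v). Qed.

Lemma normV_minus (v w : V) : norm (minus v w) <= norm v + norm w.
Proof. unfold minus. rewrite <- (normV_opp w). apply normV_plus. Qed.

Lemma normV_eq0 (v : V) : norm v <= 0 -> v = zero.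
Proof. intros H. apply (norm_eq_zero (V := V)). generalize (norm_ge_0 v); lra. Qed.

Lemma cs_linear c : is_linear (cs c).
Proof.
  split.
  - intros; apply cs_plus_r.
  - intros r v. rewrite <- !cs_real, <- !cs_mult. f_equal. ring.
  - exists (kappa * Cmod c + 1). split.
    + generalize (Cmod_ge_0 c); intros; nra.
    + intros v. generalize (norm_cs c v) (norm_ge_0 v); intros; nra.
Qed.

(** * Integrals along one curve *)

Definition is_lint (g : R -> R * R) (F : C -> V) (v : V) : Prop :=
  is_RInt (fun t => cs (velocity g t) (F (g t))) 0 1 v.

Lemma is_lint_ext g (F G : C -> V) v :
  (forall t, 0 <= t <= 1 -> F (g t) = G (g t)) -> is_lint g F v -> is_lint g G v.
Proof.
  intros E. apply is_RInt_ext. rewrite Rmin_left, Rmax_right by lra.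
  intros t Ht. rewrite E by lra. reflexivity.
Qed.

Lemma is_lint_linear g (L : V -> V) (F : C -> V) v :
  is_linear L -> (forall c y, L (cs c y) = cs c (L y)) ->
  is_lint g F v -> is_lint g (fun s => L (F s)) (L v).
Proof.
  intros HL Hc H. unfold is_lint.
  apply (is_RInt_ext (fun t => L (cs (velocity g t) (F (g t))))).
  - intros; apply Hc.
  - apply (is_RInt_linear L); assumption.
Qed.

Lemma is_lint_plus g (F G : C -> V) v w :
  is_lint g F v -> is_lint g G w -> is_lint g (fun s => plus (F s) (G s)) (plus v w).
Proof.
  intros HF HG. unfold is_lint.
  apply (is_RInt_ext (fun t => plus (cs (velocity g t) (F (g t))) (cs (velocity g t) (G (g t))))).
  - intros; symmetry; apply cs_plus_r.
  - apply (is_RInt_plus (V := V)); assumption.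
Qed.

Lemma is_lint_norm g (F : C -> V) v L B :
  (forall t, 0 <= t <= 1 -> Cmod (velocity g t) <= L) ->
  (forall t, 0 <= t <= 1 -> norm (F (g t)) <= B) ->
  is_lint g F v -> norm v <= kappa * L * B.
Proof.
  intros HL HB H. replace (kappa * L * B) with ((1 - 0) * (kappa * L * B)) by ring.
  apply (norm_RInt_le_const (V := V) _ 0 1 v (kappa * L * B) ltac:(lra)) with (2 := H).
  intros t Ht. eapply Rle_trans; [apply norm_cs|].
  specialize (HL t Ht). specialize (HB t Ht).
  apply Rmult_le_compat; [|apply norm_ge_0| |exact HB].
  - apply Rmult_le_pos; [lra | apply Cmod_ge_0].
  - apply Rmult_le_compat_l; [lra | exact HL].
Qed.

Lemma ex_lint g (F : C -> V) :
  pw_C1 g -> cont_on (fun t => F (g t)) 0 1 -> exists v, is_lint g F v.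
Proof.
  intros Hg HF. apply (ex_RInt_velocity (V := V) g (fun t => F (g t)) (fun t => j (F (g t))) Hg HF).
  apply (cont_on_comp (fun t => F (g t)) j 0 1 HF). intros t _; exact (linear_cont j (F (g t)) j_linear).
Qed.

(** With [ds = dx + i dy], the hypotheses are the real and the imaginary part of the integral of
    [psi ds]. The fixed vector [x] comes out, leaving two real integrals. *)
Lemma is_lint_scalar g (psi : C -> C) (a b : R) x :
  is_RInt (fun t => fst (psi (g t)) * Derive (cx g) t + - snd (psi (g t)) * Derive (cy g) t) 0 1 a ->
  is_RInt (fun t => snd (psi (g t)) * Derive (cx g) t + fst (psi (g t)) * Derive (cy g) t) 0 1 b ->
  is_lint g (fun s => cs (psi s) x) (cs (a, b) x).
Proof.
  intros Ha Hb.
  assert (Hl : forall y : V, is_linear (U := R_NormedModule) (fun r : R => scal r y)).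
  { intros y. exact (is_linear_scal_l (K := R_AbsRing) (V := V) y). }
  unfold is_lint.
  apply (is_RInt_ext (fun t =>
    plus (scal (fst (psi (g t)) * Derive (cx g) t + - snd (psi (g t)) * Derive (cy g) t) x)
         (scal (snd (psi (g t)) * Derive (cx g) t + fst (psi (g t)) * Derive (cy g) t) (j x)))).
  - intros t _. rewrite <- cs_mult. unfold cs, velocity; simpl. f_equal; f_equal; ring.
  - apply (is_RInt_plus (V := V));
      [apply (is_RInt_linear (U := R_NormedModule) (fun r => scal r x))
      |apply (is_RInt_linear (U := R_NormedModule) (fun r => scal r (j x)))]; auto.
Qed.

(** [Phi] is a primitive along the parametrised curve rather than on a region of the plane; the
    integral is its increment, which vanishes on a closed curve. *)
Lemma is_lint_exact g (psi : C -> C) (Phi : R -> C) x :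
  pw_C1 g -> ccont Phi -> ccont (fun t => psi (g t)) ->
  (forall t d, 0 <= t <= 1 -> is_cderive g t d -> is_cderive Phi t (Cmult (psi (g t)) d)) ->
  Phi 0 = Phi 1 -> is_lint g (fun s => cs (psi s) x) zero.
Proof.
  intros Hg [HP1 HP2] [Hp1 Hp2] Hd Hper.
  replace (zero : V) with (cs (fst (Phi 1) - fst (Phi 0), snd (Phi 1) - snd (Phi 0)) x).
  2: { rewrite Hper, !Rminus_diag. apply (cs_0 x). }
  apply is_lint_scalar.
  - apply (is_RInt_exact g (fun t => fst (Phi t)) (fun t => fst (psi (g t)))
             (fun t => - snd (psi (g t))) Hg HP1 Hp1); [apply cont_on_Ropp, Hp2|].
    intros t dx dy Ht H1 H2. destruct (Hd t (dx, dy) Ht (conj H1 H2)) as [H _].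
    evar_last; [exact H | simpl; ring].
  - apply (is_RInt_exact g (fun t => snd (Phi t)) (fun t => snd (psi (g t)))
             (fun t => fst (psi (g t))) Hg HP2 Hp2); [exact Hp1|].
    intros t dx dy Ht H1 H2. destruct (Hd t (dx, dy) Ht (conj H1 H2)) as [_ H].
    evar_last; [exact H | simpl; ring].
Qed.

Lemma ccont_curve g : jordan_curve g -> ccont g.
Proof. intros (H & _). apply ccont_cont_on, H. Qed.

Lemma ccont_curve_minus g w : jordan_curve g -> ccont (fun t => Cminus (g t) w).
Proof.
  intros H. apply (ccont_plus g (fun _ => Copp w)); [apply ccont_curve, H | apply ccont_const].
Qed.

Lemma is_lint_pow g k x : jordan_curve g -> is_lint g (fun s => cs (s ^ k)%C x) zero.
Proof.
  intros Hg.
  apply (is_lint_exact g (fun s => (s ^ k)%C)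
           (fun t => Cmult (Cinv (INR (S k))) (g t ^ S k)%C)).
  - apply Hg.
  - apply ccont_mult; [apply ccont_const | apply ccont_pow, ccont_curve, Hg].
  - apply ccont_pow, ccont_curve, Hg.
  - intros t d _ Hd.
    eapply eq_ind; [apply (is_cderive_mult _ _ t _ _ (is_cderive_const _ t)
                             (is_cderive_pow g k t d Hd))|].
    field. intros E. injection E as E. revert E. apply (not_0_INR (S k)). lia.
  - destruct Hg as (_ & E & _). rewrite E. reflexivity.
Qed.

Section WindingNumber.
Variables (g : R -> R * R) (w : C).
Hypothesis g_jordan : jordan_curve g.
Hypothesis g_avoids : forall t, 0 <= t <= 1 -> g t <> w.

Lemma curve_minus_neq0 t : 0 <= t <= 1 -> Cminus (g t) w <> 0.
Proof.
  intros Ht H. apply (g_avoids t Ht).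
  assert (E : Cplus (Cminus (g t) w) w = g t) by ring.
  rewrite H in E. rewrite <- E. apply Cplus_0_l.
Qed.

Lemma ccont_curve_inv : ccont (fun t => Cinv (Cminus (g t) w)).
Proof. apply ccont_inv; [exact curve_minus_neq0 | apply ccont_curve_minus, g_jordan]. Qed.

Lemma is_lint_inv2 x :
  is_lint g (fun s => cs (Cmult (Cinv (Cminus s w)) (Cinv (Cminus s w))) x) zero.
Proof.
  apply (is_lint_exact g (fun s => Cmult (Cinv (Cminus s w)) (Cinv (Cminus s w)))
           (fun t => Cmult (-(1)) (Cinv (Cminus (g t) w)))).
  - apply g_jordan.
  - apply ccont_mult; [apply ccont_const | apply ccont_curve_inv].
  - apply (ccont_mult (fun t => Cinv (Cminus (g t) w)) (fun t => Cinv (Cminus (g t) w)));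
      apply ccont_curve_inv.
  - intros t d Ht Hd.
    assert (Hi := is_cderive_inv (fun s => Cminus (g s) w) t _ (curve_minus_neq0 t Ht)
      (is_cderive_plus g (fun _ => Copp w) t _ _ Hd (is_cderive_const _ t))).
    eapply eq_ind; [apply (is_cderive_mult _ _ t _ _ (is_cderive_const (-(1)) t) Hi)|].
    ring.
  - destruct g_jordan as (_ & E & _). rewrite E. reflexivity.
Qed.

(* The real part of [1 / (s - w)] integrates to the increment of [ln |s - w|]. *)
Lemma is_lint_inv x :
  is_lint g (fun s => cs (Cinv (Cminus s w)) x) (cs (0, 2 * PI * wind g w) x).
Proof.
  destruct ccont_curve_inv as [C1 C2]. apply is_lint_scalar.
  - set (n2 := fun t => fst (Cminus (g t) w) ^ 2 + snd (Cminus (g t) w) ^ 2).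
    assert (Hn2 : forall t, 0 <= t <= 1 -> 0 < n2 t).
    { intros t Ht. assert (H := Cnorm2_neq0 _ (curve_minus_neq0 t Ht)). unfold n2.
      generalize (pow2_ge_0 (fst (Cminus (g t) w))) (pow2_ge_0 (snd (Cminus (g t) w))). lra. }
    apply (eq_ind (/ 2 * ln (n2 1) - / 2 * ln (n2 0)) (fun r => is_RInt _ 0 1 r)).
    2: { unfold n2. destruct g_jordan as (_ & E & _). rewrite E. ring. }
    apply (is_RInt_exact g (fun t => / 2 * ln (n2 t)) (fun t => fst (Cinv (Cminus (g t) w)))
             (fun t => - snd (Cinv (Cminus (g t) w)))); [apply g_jordan | | exact C1 | |].
    + apply (cont_on_Rmult (fun _ => / 2)); [lra | apply (cont_on_const (V := R_UniformSpace)) |].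
      destruct (ccont_curve_minus g w g_jordan) as [D1 D2].
      apply (cont_on_comp n2 ln).
      * apply cont_on_Rplus; [lra | |]; apply cont_on_sqr; lra || assumption.
      * intros t Ht. apply continuity_pt_filterlim.
        apply derivable_continuous_pt. exists (/ n2 t). apply derivable_pt_lim_ln, Hn2, Ht.
    + apply (cont_on_Ropp (fun t => snd (Cinv (Cminus (g t) w)))), C2.
    + intros t dx dy Ht H1 H2. specialize (Hn2 t Ht).
      destruct (is_cderive_plus g (fun _ => Copp w) t (dx, dy) _ (conj H1 H2)
                  (is_cderive_const _ t)) as [D1 D2].
      evar_last.
      * apply (is_derive_scal (fun s => ln (n2 s))).
        apply (is_derive_comp ln n2); [apply is_derive_ln, Hn2|].
        apply (is_derive_plus (K := R_AbsRing) (V := R_NormedModule)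
               (fun s => fst (Cplus (g s) (Copp w)) ^ 2)
               (fun s => snd (Cplus (g s) (Copp w)) ^ 2));
          apply is_derive_pow; eassumption.
      * unfold n2 in Hn2. unfold n2, plus, scal; simpl in *. unfold mult; simpl. field. lra.
  - replace (2 * PI * wind g w) with
      (RInt (fun t => snd (Cinv (Cminus (g t) w)) * Derive (cx g) t +
                      fst (Cinv (Cminus (g t) w)) * Derive (cy g) t) 0 1).
    + apply (RInt_correct (V := R_CompleteNormedModule)).
      apply (ex_RInt_ext (fun t => plus
               (scal (Derive (cx g) t) (snd (Cinv (Cminus (g t) w))))
               (scal (Derive (cy g) t) (fst (Cinv (Cminus (g t) w)))))).
      * intros t _. unfold plus, scal; simpl. unfold mult; simpl. ring.
      * apply (ex_RInt_velocity (V := R_CompleteNormedModule)); [apply g_jordan | |]; assumption.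
    + unfold wind. rewrite <- Rmult_assoc, Rinv_r, Rmult_1_l.
      2: { generalize PI_RGT_0; lra. }
      apply RInt_ext. intros t _. unfold cx, cy, Cinv; simpl. unfold Rdiv, Rminus. ring.
Qed.
End WindingNumber.

(** * Integrals over a finite family of curves *)

Fixpoint is_cint (gs : list (R -> R * R)) (F : C -> V) (v : V) : Prop :=
  match gs with
  | nil => v = zero
  | g :: gs' => exists v1 v2, is_lint g F v1 /\ is_cint gs' F v2 /\ v = plus v1 v2
  end.

Definition on_cycle (gs : list (R -> R * R)) (z : C) : Prop :=
  exists g, In g gs /\ exists t, 0 <= t <= 1 /\ g t = z.

Lemma on_cycle_head g gs t : 0 <= t <= 1 -> on_cycle (g :: gs) (g t).
Proof. intros Ht. exists g. split; [left; reflexivity | exists t; auto]. Qed.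

Lemma on_cycle_tail g gs z : on_cycle gs z -> on_cycle (g :: gs) z.
Proof. intros (g' & Hg & H). exists g'. split; [right; exact Hg | exact H]. Qed.

Lemma is_cint_ext gs (F G : C -> V) v :
  (forall z, on_cycle gs z -> F z = G z) -> is_cint gs F v -> is_cint gs G v.
Proof.
  revert v; induction gs as [|g gs IH]; intros v E; [auto|].
  intros (v1 & v2 & H1 & H2 & ->). exists v1, v2. repeat split.
  - apply (is_lint_ext g F); [|exact H1]. intros t Ht; apply E, on_cycle_head, Ht.
  - apply IH; [|exact H2]. intros z Hz; apply E, on_cycle_tail, Hz.
Qed.

Lemma is_cint_linear gs (L : V -> V) (F : C -> V) v :
  is_linear L -> (forall c y, L (cs c y) = cs c (L y)) ->
  is_cint gs F v -> is_cint gs (fun s => L (F s)) (L v).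
Proof.
  intros HL Hc; revert v; induction gs as [|g gs IH]; intros v.
  - intros ->. rewrite <- (cs_0 zero), Hc. apply cs_0.
  - intros (v1 & v2 & H1 & H2 & ->). exists (L v1), (L v2). repeat split.
    + apply is_lint_linear; assumption.
    + apply IH, H2.
    + apply (linear_plus L HL).
Qed.

Lemma is_cint_cs gs c (F : C -> V) v :
  is_cint gs F v -> is_cint gs (fun s => cs c (F s)) (cs c v).
Proof.
  apply is_cint_linear; [apply cs_linear|]. intros; rewrite <- !cs_mult. f_equal; ring.
Qed.

Lemma is_cint_plus gs (F G : C -> V) v w :
  is_cint gs F v -> is_cint gs G w -> is_cint gs (fun s => plus (F s) (G s)) (plus v w).
Proof.
  revert v w; induction gs as [|g gs IH]; intros v w.
  - intros -> ->. simpl. apply plus_zero_l.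
  - intros (v1 & v2 & H1 & H2 & ->) (w1 & w2 & H3 & H4 & ->).
    exists (plus v1 w1), (plus v2 w2). repeat split.
    + apply is_lint_plus; assumption.
    + apply IH; assumption.
    + cmodule.
Qed.

Lemma is_cint_minus gs (F G : C -> V) v w :
  is_cint gs F v -> is_cint gs G w -> is_cint gs (fun s => minus (F s) (G s)) (minus v w).
Proof.
  intros HF HG. apply (is_cint_cs _ (Copp 1)) in HG.
  replace (minus v w) with (plus v (cs (Copp 1) w)) by cmodule.
  apply (is_cint_ext gs (fun s => plus (F s) (cs (Copp 1) (G s)))).
  - intros z _. cmodule.
  - apply is_cint_plus; assumption.
Qed.

Lemma is_cint_unique gs (F : C -> V) v w : is_cint gs F v -> is_cint gs F w -> v = w.
Proof.
  revert v w; induction gs as [|g gs IH]; intros v w.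
  - intros -> ->; reflexivity.
  - intros (v1 & v2 & H1 & H2 & ->) (w1 & w2 & H3 & H4 & ->).
    rewrite (IH _ _ H2 H4). f_equal.
    rewrite <- (is_RInt_unique (V := V) _ _ _ _ H1). apply is_RInt_unique, H3.
Qed.

(** [L] is a sum of speed bounds, one for each curve, weighted by [kappa]. It is quantified before
    [F], so one constant serves every integrand; [taylor_inside] relies on this. *)
Lemma is_cint_norm gs :
  List.Forall jordan_curve gs -> exists L, 0 <= L /\ forall (F : C -> V) v B,
    0 <= B -> (forall z, on_cycle gs z -> norm (F z) <= B) -> is_cint gs F v -> norm v <= L * B.
Proof.
  intros Hgs; induction Hgs as [|g gs Hg Hgs (L & HL & IH)].
  - exists 0. split; [lra|]. intros F v B HB _ ->. rewrite normV_zero. lra.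
  - destruct (velocity_bounded g) as (L' & HL' & Hv); [apply Hg|].
    exists (kappa * L' + L). split; [nra|].
    intros F v B HB HF (v1 & v2 & H1 & H2 & ->).
    eapply Rle_trans; [apply normV_plus|].
    rewrite Rmult_plus_distr_r. apply Rplus_le_compat.
    + apply (is_lint_norm g F); [exact Hv | | exact H1].
      intros t Ht; apply HF, on_cycle_head, Ht.
    + apply (IH F); [exact HB | | exact H2]. intros z Hz; apply HF, on_cycle_tail, Hz.
Qed.

Definition cont_on_cycle (gs : list (R -> R * R)) (F : C -> V) : Prop :=
  forall g, In g gs -> cont_on (fun t => F (g t)) 0 1.

Lemma cont_on_cycle_bounded gs (F : C -> V) :
  cont_on_cycle gs F -> exists M, 0 <= M /\ forall z, on_cycle gs z -> norm (F z) <= M.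
Proof.
  induction gs as [|g gs IH]; intros HF.
  - exists 0. split; [lra|]. intros z (g & [] & _).
  - destruct IH as (M & HM & H); [intros g' Hg'; apply HF; right; exact Hg'|].
    destruct (cont_on_bounded (V := V) (fun t => F (g t)) 0 1) as (M' & HM' & H');
      [lra | apply HF; left; reflexivity |].
    exists (M + M'). split; [lra|].
    intros z (g' & [<-|Hg'] & t & Ht & <-).
    + specialize (H' t Ht). lra.
    + assert (norm (F (g' t)) <= M); [|lra]. apply H. exists g'. split; [exact Hg'|]. exists t; auto.
Qed.

Lemma cont_on_cycle_cs gs (psi : C -> C) (F : C -> V) :
  (forall g, In g gs -> ccont (fun t => psi (g t))) -> cont_on_cycle gs F ->
  cont_on_cycle gs (fun s => cs (psi s) (F s)).
Proof.
  intros Hpsi HF g Hg. destruct (Hpsi g Hg) as [H1 H2]. specialize (HF g Hg).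
  apply (cont_on_plus (V := V) (fun t => scal (fst (psi (g t))) (F (g t)))
           (fun t => scal (snd (psi (g t))) (j (F (g t))))); [lra | |].
  - apply (cont_on_scal (V := V) (fun t => fst (psi (g t)))); [lra | assumption | assumption].
  - apply (cont_on_scal (V := V) (fun t => snd (psi (g t)))); [lra | assumption |].
    apply (cont_on_comp (fun t => F (g t)) j 0 1 HF).
    intros t _; exact (linear_cont j (F (g t)) j_linear).
Qed.

Lemma ex_cint gs (F : C -> V) :
  List.Forall jordan_curve gs -> cont_on_cycle gs F -> exists v, is_cint gs F v.
Proof.
  intros Hgs; induction Hgs as [|g gs Hg Hgs IH]; intros HF.
  - exists zero. reflexivity.
  - destruct IH as (v2 & H2); [intros g' Hg'; apply HF; right; exact Hg'|].
    destruct (ex_lint g F) as (v1 & H1); [apply Hg | apply HF; left; reflexivity|].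
    exists (plus v1 v2), v1, v2. auto.
Qed.

Lemma is_cint_pow gs k x :
  List.Forall jordan_curve gs -> is_cint gs (fun s => cs (s ^ k)%C x) zero.
Proof.
  intros Hgs; induction Hgs as [|g gs Hg Hgs IH]; [reflexivity|].
  exists zero, zero. split; [apply is_lint_pow, Hg|]. split; [exact IH|].
  symmetry; apply plus_zero_l.
Qed.

Lemma is_cint_inv2 gs w x :
  List.Forall jordan_curve gs -> ~ on_cycle gs w ->
  is_cint gs (fun s => cs (Cmult (Cinv (Cminus s w)) (Cinv (Cminus s w))) x) zero.
Proof.
  intros Hgs; induction Hgs as [|g gs Hg Hgs IH]; intros Hw; [reflexivity|].
  exists zero, zero. repeat split.
  - apply is_lint_inv2; [exact Hg|]. intros t Ht E. apply Hw. rewrite <- E.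
    apply on_cycle_head, Ht.
  - apply IH. intros H; apply Hw, on_cycle_tail, H.
  - symmetry; apply plus_zero_l.
Qed.

Lemma is_cint_inv gs w x :
  List.Forall jordan_curve gs -> ~ on_cycle gs w ->
  is_cint gs (fun s => cs (Cinv (Cminus s w)) x)
    (cs (0, 2 * PI * fold_right (fun g acc => wind g w + acc) 0 gs) x).
Proof.
  intros Hgs; induction Hgs as [|g gs Hg Hgs IH]; intros Hw.
  - simpl. rewrite Rmult_0_r. apply (cs_0 x).
  - eexists; eexists. split; [|split].
    + apply is_lint_inv; [exact Hg|]. intros t Ht E. apply Hw. rewrite <- E.
      apply on_cycle_head, Ht.
    + apply IH. intros H; apply Hw, on_cycle_tail, H.
    + rewrite <- cs_plus_l. f_equal. unfold Cplus; simpl. f_equal; ring.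
Qed.

(** * Liouville's theorem *)

Fixpoint vsum (f : nat -> V) (n : nat) : V :=
  match n with O => zero | S k => plus (vsum f k) (f k) end.

Lemma vsum_norm f n B : (forall k, norm (f k) <= B) -> norm (vsum f n) <= INR n * B.
Proof.
  intros H; induction n.
  - simpl (vsum f 0). rewrite normV_zero. simpl; lra.
  - rewrite S_INR. simpl vsum. eapply Rle_trans; [apply normV_plus|].
    specialize (H n). lra.
Qed.

Lemma vsum_ext f g n : (forall k, f k = g k) -> vsum f n = vsum g n.
Proof. intros H; induction n; simpl; [reflexivity | rewrite IHn, H; reflexivity]. Qed.

Lemma vsum_minus f g n : vsum (fun k => minus (f k) (g k)) n = minus (vsum f n) (vsum g n).
Proof. induction n; simpl; [|rewrite IHn]; cmodule. Qed.

Lemma vsum_cs c f n : vsum (fun k => cs c (f k)) n = cs c (vsum f n).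
Proof. induction n; simpl; [|rewrite IHn]; cmodule. Qed.

Lemma vsum_telescope f n : vsum (fun k => minus (f (S k)) (f k)) n = minus (f n) (f O).
Proof. induction n; simpl; [|rewrite IHn]; cmodule. Qed.

Lemma vsum_const v n : vsum (fun _ => v) n = cs (RtoC (INR n)) v.
Proof.
  induction n; [simpl; rewrite cs_0; reflexivity|].
  rewrite S_INR, RtoC_plus. simpl vsum. rewrite IHn. cmodule.
Qed.

(** * Averages over roots of unity *)

Section MeanValue.
Variables (h h1 : C -> V) (rad K eta : R).
Hypothesis rad_pos : 0 < rad.
Hypothesis K_pos : 0 <= K.
Hypothesis h_taylor : forall w d, Cmod w <= rad -> Cmod d < eta ->
  norm (minus (minus (h (Cplus w d)) (h w)) (cs d (h1 w))) <= K * (Cmod d * Cmod d).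
Variable n : nat.
Hypothesis n_large : (2 <= n)%nat.
Hypothesis step_small : 2 * PI * rad < eta * INR n.

(** The [e k] are the [n]-th roots of unity, [M r] is [n] times the mean of [h] over the
    corresponding points of the circle of radius [r], and [D r] is the radial derivative of [M] when
    [h1] is the derivative of [h]. By [step_small] neighbouring points are closer than [eta]. *)
Let th : R := 2 * PI / INR n.
Let e (k : nat) : C := (cos (INR k * th), sin (INR k * th)).
Let om : C := (cos th, sin th).
Let M (r : R) : V := vsum (fun k => h (Cmult r (e k))) n.
Let D (r : R) : V := vsum (fun k => cs (e k) (h1 (Cmult r (e k)))) n.

Lemma n_pos : 2 <= INR n.
Proof. change 2 with (INR 2). apply le_INR, n_large. Qed.

Lemma th_bounds : 0 < th <= PI.
Proof.
  assert (Hn := n_pos). assert (HP := PI_RGT_0). unfold th. split.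
  - apply Rdiv_lt_0_compat; lra.
  - apply Rle_div_l; nra.
Qed.

Lemma Cmod_cos_sin a : Cmod (cos a, sin a) = 1.
Proof.
  unfold Cmod; simpl fst; simpl snd. rewrite <- sqrt_1. f_equal.
  generalize (sin2_cos2 a). unfold Rsqr. lra.
Qed.

Lemma Cmod_e k : Cmod (e k) = 1.
Proof. apply Cmod_cos_sin. Qed.

Lemma e_S k : e (S k) = Cmult (e k) om.
Proof.
  unfold e, om, Cmult. cbn [fst snd]. rewrite S_INR.
  replace ((INR k + 1) * th) with (INR k * th + th) by ring.
  rewrite cos_plus, sin_plus. f_equal; ring.
Qed.

Lemma e_period : e n = e 0.
Proof.
  unfold e, th. assert (Hn := n_pos).
  replace (INR n * (2 * PI / INR n)) with (2 * PI) by (field; lra).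
  rewrite cos_2PI, sin_2PI. simpl (INR 0). rewrite Rmult_0_l, cos_0, sin_0. reflexivity.
Qed.

(** The chord of the angle [th] has length [2 * sin (th / 2)], which is positive and at most the
    arc. *)
Lemma om_1 : 0 < Cmod (Cminus om 1) <= th.
Proof.
  assert (Ht := th_bounds).
  assert (Hs : 0 < sin (th / 2) <= th / 2).
  { split; [apply sin_gt_0; lra|]. left; apply sin_lt_x; lra. }
  assert (E : Cmod (Cminus om 1) = 2 * sin (th / 2)).
  { unfold Cmod, om; simpl fst; simpl snd.
    rewrite <- (sqrt_pow2 (2 * sin (th / 2))) by lra. f_equal.
    assert (E1 := cos_2a_sin (th / 2)). replace (2 * (th / 2)) with th in E1 by field.
    assert (E2 := sin2_cos2 th). unfold Rsqr in *.
    replace (cos th + - (1)) with (cos th - 1) by ring.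
    replace (sin th + - 0) with (sin th) by ring. nra. }
  rewrite E; lra.
Qed.

Lemma Cmod_scaled r z : 0 <= r -> Cmod (Cmult (RtoC r) z) = r * Cmod z.
Proof. intros Hr. rewrite Cmod_mult, Cmod_R, Rabs_pos_eq by exact Hr. reflexivity. Qed.

(* The increments of [h] around the circle of radius [r] add up to zero. *)
Lemma circle_derivative r : 0 < r <= rad -> norm (D r) <= kappa * (INR n * K * rad * th).
Proof.
  intros Hr. assert (Ho := om_1). assert (Hn := n_pos). assert (HP := PI_RGT_0).
  set (dl := Cminus om 1) in *.
  assert (Hs : r * Cmod dl < eta).
  { apply (Rle_lt_trans _ (rad * th)); [apply Rmult_le_compat; lra|].
    apply (Rmult_lt_reg_r (INR n)); [lra|]. unfold th.
    replace (rad * (2 * PI / INR n) * INR n) with (2 * PI * rad) by (field; lra).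
    exact step_small. }
  assert (H : norm (cs (Cmult r dl) (D r)) <= INR n * (K * ((r * Cmod dl) * (r * Cmod dl)))).
  { replace (cs (Cmult r dl) (D r)) with
      (opp (vsum (fun k => minus (minus (h (Cmult r (e (S k)))) (h (Cmult r (e k))))
                   (cs (Cmult (Cmult r dl) (e k)) (h1 (Cmult r (e k))))) n)).
    - rewrite normV_opp. apply vsum_norm. intros k.
      replace (Cmult r (e (S k))) with (Cplus (Cmult r (e k)) (Cmult (Cmult r dl) (e k))).
      2: { rewrite e_S. unfold dl. ring. }
      assert (Ed : Cmod (Cmult (Cmult r dl) (e k)) = r * Cmod dl).
      { rewrite Cmod_mult, Cmod_e, Rmult_1_r, Cmod_scaled by lra. reflexivity. }
      rewrite <- Ed. apply h_taylor; [|rewrite Ed; exact Hs].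
      rewrite Cmod_scaled, Cmod_e by lra. lra.
    - rewrite vsum_minus, (vsum_telescope (fun k => h (Cmult r (e k)))), e_period.
      rewrite (vsum_ext _ (fun k => cs (Cmult r dl) (cs (e k) (h1 (Cmult r (e k))))))
        by (intros; apply cs_mult).
      rewrite vsum_cs. fold (D r). cmodule. }
  assert (H' := norm_cs_lower (Cmult r dl) (D r)). rewrite Cmod_scaled in H' by lra.
  apply (Rmult_le_reg_l (r * Cmod dl)); [nra|].
  eapply Rle_trans; [exact H'|].
  apply (Rle_trans _ (kappa * (INR n * (K * ((r * Cmod dl) * (r * Cmod dl)))))).
  { apply Rmult_le_compat_l; lra. }
  replace (kappa * (INR n * (K * (r * Cmod dl * (r * Cmod dl)))))
    with (r * Cmod dl * (kappa * (INR n * K) * (r * Cmod dl))) by ring.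
  replace (kappa * (INR n * K * rad * th)) with (kappa * (INR n * K) * (rad * th)) by ring.
  apply Rmult_le_compat_l; [nra|]. apply Rmult_le_compat_l.
  - apply Rmult_le_pos; [lra|]. apply Rmult_le_pos; lra.
  - apply Rmult_le_compat; lra.
Qed.

(** A Taylor expansion along each of the [n] radii: the first-order terms add up to [cs d (D r)],
    which [circle_derivative] controls, and the remainders are quadratic in [d]. *)
Lemma circle_step r d : 0 < r <= rad -> Rabs d < eta ->
  norm (minus (M (r + d)) (M r)) <=
  INR n * (K * (Rabs d * Rabs d)) + kappa * Rabs d * norm (D r).
Proof.
  intros Hr Hd.
  replace (minus (M (r + d)) (M r)) with
    (plus (vsum (fun k => minus (minus (h (Cplus (Cmult r (e k)) (Cmult d (e k))))
                  (h (Cmult r (e k)))) (cs (Cmult d (e k)) (h1 (Cmult r (e k))))) n)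
          (cs d (D r))).
  - eapply Rle_trans; [apply normV_plus|]. apply Rplus_le_compat.
    + apply vsum_norm. intros k.
      assert (Ed : Cmod (Cmult d (e k)) = Rabs d).
      { rewrite Cmod_mult, Cmod_e, Cmod_R. ring. }
      rewrite <- Ed. apply h_taylor; [|rewrite Ed; exact Hd].
      rewrite Cmod_scaled, Cmod_e by lra. lra.
    + rewrite <- Cmod_R. apply norm_cs.
  - rewrite !vsum_minus.
    rewrite (vsum_ext (fun k => cs (Cmult d (e k)) _)
               (fun k => cs d (cs (e k) (h1 (Cmult r (e k)))))) by (intros; apply cs_mult).
    rewrite vsum_cs. fold (D r).
    rewrite (vsum_ext (fun k => h (Cplus _ _)) (fun k => h (Cmult (r + d)%R (e k)))).
    2: { intros k. f_equal. rewrite RtoC_plus. ring. }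
    fold (M (r + d)) (M r). cmodule.
Qed.

(** One radial step of length [rad / n] costs the remainders [n * K * (rad / n)^2] and
    [kappa * (rad / n)] times the bound of [circle_derivative]. With [th = 2 * PI / n] the total is
    [c1 / n], so all [n] steps cost [c1], whatever [n] is. *)
Let c1 : R := K * (rad * rad) * (1 + kappa * kappa * (2 * PI)).

Lemma circle_step_bound l : (l < n)%nat ->
  norm (minus (M (rad * INR l / INR n)) (M (rad * INR (S l) / INR n))) <= c1 / INR n.
Proof.
  intros Hl. assert (Hn := n_pos). assert (HP := PI_RGT_0). assert (Hp := PI2_3_2).
  (* The expansion is made at the outer radius with a negative step, because [circle_derivative]
     requires a positive radius; the centre occurs only as an end point, for [l = 0]. *)
  set (r := rad * INR (S l) / INR n). set (d := - (rad / INR n)).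
  assert (Hd : Rabs d = rad / INR n).
  { unfold d. rewrite Rabs_Ropp, Rabs_pos_eq; [reflexivity|].
    apply Rlt_le, Rdiv_lt_0_compat; lra. }
  assert (Hr : 0 < r <= rad).
  { assert (0 < INR (S l) <= INR n) by (split; [apply lt_0_INR; lia | apply le_INR; lia]).
    unfold r; split; [apply Rdiv_lt_0_compat; nra|]. apply Rle_div_l; nra. }
  replace (rad * INR l / INR n) with (r + d).
  2: { unfold r, d. rewrite S_INR. field; lra. }
  eapply Rle_trans; [apply circle_step; [exact Hr|]|].
  - rewrite Hd. apply Rlt_div_l; [lra|].
    eapply Rle_lt_trans; [|exact step_small]. nra.
  - rewrite Hd. apply (Rle_trans _ (INR n * (K * (rad / INR n * (rad / INR n))) +
      kappa * (rad / INR n) * (kappa * (INR n * K * rad * th)))).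
    + apply Rplus_le_compat_l, Rmult_le_compat_l; [|apply circle_derivative, Hr].
      apply Rmult_le_pos; [lra|]. apply Rlt_le, Rdiv_lt_0_compat; lra.
    + right. unfold c1, th. field. lra.
Qed.

Lemma circle_mean : norm (minus (M 0) (M rad)) <= c1.
Proof.
  assert (Hn := n_pos).
  assert (H : forall l, (l <= n)%nat ->
    norm (minus (M 0) (M (rad * INR l / INR n))) <= INR l * (c1 / INR n)).
  { induction l; intros Hl.
    - simpl (INR 0). replace (rad * 0 / INR n) with 0 by (field; lra).
      replace (minus (M 0) (M 0)) with (zero : V) by cmodule. rewrite normV_zero; lra.
    - replace (minus (M 0) (M (rad * INR (S l) / INR n))) with
        (plus (minus (M 0) (M (rad * INR l / INR n)))
           (minus (M (rad * INR l / INR n)) (M (rad * INR (S l) / INR n)))) by cmodule.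
      eapply Rle_trans; [apply normV_plus|].
      assert (H1 := IHl ltac:(lia)). assert (H2 := circle_step_bound l ltac:(lia)).
      rewrite (S_INR l) at 2. lra. }
  specialize (H n (le_n n)).
  replace (rad * INR n / INR n) with rad in H by (field; lra).
  replace (INR n * (c1 / INR n)) with c1 in H by (field; lra). exact H.
Qed.

(** [M 0] is [n] times [h 0], while [M 0] and [M rad] differ by at most [c1]. After division by [n]
    the error is [c1 / n]. *)
Lemma mean_value_approx B : (forall w, Cmod w = rad -> norm (h w) <= B) ->
  INR n * norm (h 0) <= INR n * B + c1.
Proof.
  intros HB. assert (Hn := n_pos). assert (H := circle_mean).
  assert (HM : norm (M rad) <= INR n * B).
  { apply vsum_norm. intros k. apply HB. rewrite Cmod_scaled, Cmod_e by lra. ring. }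
  assert (H0 : M 0 = scal (INR n) (h 0)).
  { unfold M. rewrite (vsum_ext _ (fun _ => h 0)) by (intros; f_equal; ring).
    rewrite vsum_const. apply cs_real. }
  assert (E : INR n * norm (h 0) <= norm (M 0)).
  { replace (h 0) with (scal (/ INR n) (M 0)).
    2: { rewrite H0, <- !cs_real, <- cs_mult, <- RtoC_mult, Rinv_l by lra. apply cs_1. }
    apply (Rle_trans _ (INR n * (Rabs (/ INR n) * norm (M 0)))).
    - apply Rmult_le_compat_l; [lra|]. exact (norm_scal (K := R_AbsRing) (V := V) _ (M 0)).
    - right. rewrite Rabs_pos_eq by (apply Rlt_le, Rinv_0_lt_compat; lra). field; lra. }
  eapply Rle_trans; [exact E|].
  replace (M 0) with (plus (M rad) (minus (M 0) (M rad))) by cmodule.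
  eapply Rle_trans; [apply normV_plus|]. lra.
Qed.
End MeanValue.

(** A single number [eta] governs the neighbourhood, the size of [d] and, through [/ eta], the
    constant, so that compactness has only one positive function to bound below. The factor [2]
    leaves room for replacing discs by squares. *)
Definition locally_taylor (h h1 : C -> V) : Prop :=
  forall w0, exists eta, 0 < eta /\ forall w d, Cmod (Cminus w w0) < 2 * eta -> Cmod d < eta ->
    norm (minus (minus (h (Cplus w d)) (h w)) (cs d (h1 w))) <= / eta * (Cmod d * Cmod d).

Lemma taylor_on_disc h h1 rad : locally_taylor h h1 ->
  exists eta, 0 < eta /\ forall w d, Cmod w <= rad -> Cmod d < eta ->
    norm (minus (minus (h (Cplus w d)) (h w)) (cs d (h1 w))) <= / eta * (Cmod d * Cmod d).
Proof.
  intros Hloc.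
  assert (Hch : forall w0 : C, exists eta : posreal,
    forall w d, Cmod (Cminus w w0) < 2 * eta -> Cmod d < eta ->
    norm (minus (minus (h (Cplus w d)) (h w)) (cs d (h1 w))) <= / eta * (Cmod d * Cmod d)).
  { intros w0. destruct (Hloc w0) as (eta & He & H). exists (mkposreal eta He). exact H. }
  set (delta := fun u v : R => proj1_sig (constructive_indefinite_description _ (Hch (u, v)))).
  assert (Hdelta : forall u v w d, Cmod (Cminus w (u, v)) < 2 * delta u v -> Cmod d < delta u v ->
    norm (minus (minus (h (Cplus w d)) (h w)) (cs d (h1 w))) <= / delta u v * (Cmod d * Cmod d)).
  { intros u v. exact (proj2_sig (constructive_indefinite_description _ (Hch (u, v)))). }
  destruct (compactness_value_2d (- rad) rad (- rad) rad delta) as [eta He].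
  exists eta. split; [apply cond_pos|]. intros w d Hw Hd.
  assert (Hm := Rmax_Cmod w).
  assert (H1 : Rabs (fst w) <= rad) by (generalize (Rmax_l (Rabs (fst w)) (Rabs (snd w))); lra).
  assert (H2 : Rabs (snd w) <= rad) by (generalize (Rmax_r (Rabs (fst w)) (Rabs (snd w))); lra).
  apply Rabs_le_between in H1. apply Rabs_le_between in H2.
  (* [compactness_value_2d] provides a centre only under a double negation, harmless here because
     the goal is recovered classically. *)
  apply NNPP. intros Hneg. apply (He (fst w) (snd w) H1 H2).
  intros (u & v & _ & _ & Hu & Hv & Hle). apply Hneg.
  eapply Rle_trans; [apply (Hdelta u v)|].
  - eapply Rle_lt_trans; [apply Cmod_2Rmax|].
    assert (Hs : sqrt 2 < 2).
    { rewrite <- (sqrt_square 2) at 2 by lra. apply sqrt_lt_1; lra. }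
    assert (Hmx : Rmax (Rabs (fst (Cminus w (u, v)))) (Rabs (snd (Cminus w (u, v)))) < delta u v).
    { apply Rmax_lub_lt; assumption. }
    assert (0 <= Rmax (Rabs (fst (Cminus w (u, v)))) (Rabs (snd (Cminus w (u, v))))).
    { eapply Rle_trans; [apply Rabs_pos | apply Rmax_l]. }
    assert (0 < sqrt 2) by (apply sqrt_lt_R0; lra). nra.
  - lra.
  - apply Rmult_le_compat_r; [generalize (Cmod_ge_0 d); intros; nra|].
    apply Rinv_le_contravar; [apply cond_pos | exact Hle].
Qed.

(** If [h 0] exceeded [B], some [N] would exceed both [c1 / (norm (h 0) - B)] and
    [2 * PI * rad / eta], and [mean_value_approx] with [N] points would fail. *)
Lemma maximum_principle_0 h h1 rad B : 0 < rad -> locally_taylor h h1 ->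
  (forall w, Cmod w = rad -> norm (h w) <= B) -> norm (h 0) <= B.
Proof.
  intros Hrad Hloc HB. destruct (taylor_on_disc h h1 rad Hloc) as (eta & He & Ht).
  apply Rnot_lt_le. intros Hlt.
  set (c1 := / eta * (rad * rad) * (1 + kappa * kappa * (2 * PI))).
  destruct (nfloor_ex (Rabs (c1 / (norm (h 0) - B)) + Rabs (2 * PI * rad / eta))) as [n [_ Hn]].
  { generalize (Rabs_pos (c1 / (norm (h 0) - B))) (Rabs_pos (2 * PI * rad / eta)). lra. }
  set (N := (n + 2)%nat).
  assert (HN : Rabs (c1 / (norm (h 0) - B)) + Rabs (2 * PI * rad / eta) < INR N).
  { unfold N. rewrite plus_INR. simpl (INR 2). lra. }
  assert (Hs : 2 * PI * rad < eta * INR N).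
  { apply (Rle_lt_trans _ (eta * Rabs (2 * PI * rad / eta))).
    - apply (Rle_trans _ (eta * (2 * PI * rad / eta))); [right; field; lra|].
      apply Rmult_le_compat_l; [lra | apply Rle_abs].
    - apply Rmult_lt_compat_l; [lra|]. generalize (Rabs_pos (c1 / (norm (h 0) - B))). lra. }
  assert (H := mean_value_approx h h1 rad (/ eta) eta Hrad
                 (Rlt_le _ _ (Rinv_0_lt_compat _ He)) Ht N ltac:(unfold N; lia) Hs B HB).
  fold c1 in H.
  assert (c1 / (norm (h 0) - B) < INR N).
  { eapply Rle_lt_trans; [apply Rle_abs|]. generalize (Rabs_pos (2 * PI * rad / eta)). lra. }
  apply (Rmult_lt_compat_r (norm (h 0) - B)) in H0; [|lra].
  replace (c1 / (norm (h 0) - B) * (norm (h 0) - B)) with c1 in H0 by (field; lra). lra.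
Qed.

Theorem liouville h h1 : locally_taylor h h1 ->
  (forall eps, 0 < eps -> exists rad, forall w, rad <= Cmod w -> norm (h w) <= eps) ->
  forall c, h c = zero.
Proof.
  intros Hloc Hinf c.
  assert (Hloc' : locally_taylor (fun w => h (Cplus c w)) (fun w => h1 (Cplus c w))).
  { intros w0. destruct (Hloc (Cplus c w0)) as (eta & He & H). exists eta. split; [exact He|].
    intros w d Hw Hd. rewrite Cplus_assoc. apply H; [|exact Hd].
    replace (Cminus (Cplus c w) (Cplus c w0)) with (Cminus w w0) by ring. exact Hw. }
  replace c with (Cplus c 0) by ring. apply normV_eq0.
  apply le_epsilon. intros eps He. rewrite Rplus_0_l.
  destruct (Hinf eps He) as (rad & Hrad).
  assert (Hc := Cmod_ge_0 c). assert (Hr := Rle_abs rad). assert (Hr' := Rabs_pos rad).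
  (* After [c] is moved to the origin, the radius [Rabs rad + Cmod c + 1] keeps [Cplus c w] in the
     region where [h] is small. *)
  apply (maximum_principle_0 (fun w => h (Cplus c w)) (fun w => h1 (Cplus c w))
           (Rabs rad + Cmod c + 1)); [lra | exact Hloc' |].
  intros w Hw. apply Hrad.
  assert (Htri := Cmod_triangle (Cplus c w) (Copp c)).
  replace (Cplus (Cplus c w) (Copp c)) with w in Htri by ring.
  rewrite Cmod_opp in Htri. lra.
Qed.

(** * Moments of the inverse of a quadratic pencil *)

Section QuadraticPencil.
Variables A N : V -> V.
Hypothesis A_linear : is_linear A.
Hypothesis N_linear : is_linear N.
Hypothesis A_cs : forall c y, A (cs c y) = cs c (A y).
Hypothesis N_cs : forall c y, N (cs c y) = cs c (N y).

Lemma A_plus u v : A (plus u v) = plus (A u) (A v).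
Proof. apply (linear_plus A A_linear). Qed.
Lemma N_plus u v : N (plus u v) = plus (N u) (N v).
Proof. apply (linear_plus N N_linear). Qed.
Lemma A_minus u v : A (minus u v) = minus (A u) (A v).
Proof.
  replace (minus u v) with (plus u (cs (Copp 1) v)) by cmodule.
  rewrite A_plus, A_cs. cmodule.
Qed.
Lemma N_minus u v : N (minus u v) = minus (N u) (N v).
Proof.
  replace (minus u v) with (plus u (cs (Copp 1) v)) by cmodule.
  rewrite N_plus, N_cs. cmodule.
Qed.

Definition pencil (w : C) (y : V) : V :=
  plus (minus (cs (Cmult w w) y) (cs w (A y))) (N y).

(** The derivative [2 w - A] of the pencil with respect to [w]. *)
Definition dpencil (w : C) (y : V) : V := minus (cs (Cplus w w) y) (A y).

Ltac pencil :=
  unfold pencil, dpencil;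
  repeat rewrite ?A_plus, ?A_minus, ?A_cs, ?N_plus, ?N_minus, ?N_cs; cmodule.

Lemma pencil_minus w u v : pencil w (minus u v) = minus (pencil w u) (pencil w v).
Proof. pencil. Qed.

Lemma pencil_cs w c y : pencil w (cs c y) = cs c (pencil w y).
Proof. pencil. Qed.

Lemma pencil_shift w d y :
  pencil (Cplus w d) y = plus (pencil w y) (cs d (plus (dpencil w y) (cs d y))).
Proof. pencil. Qed.

Lemma pencil_diff w s y :
  pencil w y = minus (pencil s y) (cs (Cminus s w) (minus (plus (cs w y) (cs s y)) (A y))).
Proof. pencil. Qed.

Lemma linear_bound (L : V -> V) : is_linear L ->
  exists M, 0 < M /\ forall y, norm (L y) <= M * norm y.
Proof. intros H; exact (linear_norm L H). Qed.

Lemma pencil_linear w : is_linear (pencil w).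
Proof.
  destruct (linear_bound A A_linear) as (MA & HMA & HA).
  destruct (linear_bound N N_linear) as (MN & HMN & HN).
  split.
  - intros; pencil.
  - intros r y. rewrite <- !cs_real. apply pencil_cs.
  - assert (H1 := Cmod_ge_0 (Cmult w w)). assert (H2 := Cmod_ge_0 w).
    exists (kappa * Cmod (Cmult w w) + kappa * Cmod w * MA + MN). split.
    + assert (0 <= kappa * Cmod (Cmult w w)) by (apply Rmult_le_pos; lra).
      assert (0 <= kappa * Cmod w * MA) by (repeat apply Rmult_le_pos; lra). lra.
    + intros y. unfold pencil.
      eapply Rle_trans; [apply normV_plus|]. rewrite 2!Rmult_plus_distr_r.
      apply Rplus_le_compat; [|apply HN].
      eapply Rle_trans; [apply normV_minus|]. apply Rplus_le_compat; [apply norm_cs|].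
      eapply Rle_trans; [apply norm_cs|]. rewrite (Rmult_assoc (kappa * Cmod w) MA).
      apply Rmult_le_compat_l; [apply Rmult_le_pos; lra | apply HA].
Qed.

Lemma dpencil_bound W : 0 <= W ->
  exists M, 0 < M /\ forall w y, Cmod w <= W -> norm (dpencil w y) <= M * norm y.
Proof.
  intros HW. destruct (linear_bound A A_linear) as (MA & HMA & HA).
  exists (kappa * (2 * W) + MA). split; [nra|]. intros w y Hw.
  eapply Rle_trans; [apply normV_minus|]. rewrite Rmult_plus_distr_r.
  apply Rplus_le_compat; [|apply HA].
  eapply Rle_trans; [apply norm_cs|]. apply Rmult_le_compat_r; [apply norm_ge_0|].
  apply Rmult_le_compat_l; [lra|].
  eapply Rle_trans; [apply Cmod_triangle|]. lra.
Qed.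

(** * Solving with the pencil outside an open set that contains its spectrum *)

Variable Om : C -> Prop.
Hypothesis Om_open : forall w, Om w ->
  exists eps, 0 < eps /\ forall z, Cmod (Cminus z w) < eps -> Om z.
Hypothesis pencil_lower : forall w, ~ Om w ->
  exists K, 0 < K /\ forall y, norm y <= K * norm (pencil w y).
Hypothesis pencil_onto : forall w, ~ Om w -> forall z, exists y, pencil w y = z.

(** By [pencil_shift] the pencils at [w] and [w0] differ on [y] by at most [c * Cmod d * norm y].
    Once [K * c * Cmod d <= / 2], this is absorbed on the left and the constant doubles. The point
    [w] itself may lie in [Om]; this is what lets estimates cross the boundary. *)
Lemma pencil_lower_near w0 : ~ Om w0 ->
  exists d K, 0 < d /\ 0 < K /\
    forall w y, Cmod (Cminus w w0) < d -> norm y <= K * norm (pencil w y).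
Proof.
  intros Hw0. destruct (pencil_lower w0 Hw0) as (K & HK & Hlow).
  destruct (dpencil_bound (Cmod w0) (Cmod_ge_0 w0)) as (M & HM & Hd).
  set (c := kappa * (M + kappa)).
  assert (Hc : 0 < c) by (unfold c; apply Rmult_lt_0_compat; lra).
  assert (Hdel : 0 < / (2 * K * c)).
  { apply Rinv_0_lt_compat. repeat apply Rmult_lt_0_compat; lra. }
  exists (Rmin 1 (/ (2 * K * c))), (2 * K).
  split; [apply Rmin_pos; lra|]. split; [lra|]. intros w y Hw.
  apply Rmin_Rgt in Hw; destruct Hw as [Hw1 Hw2].
  set (d := Cminus w w0) in *. assert (Hd0 := Cmod_ge_0 d). assert (Hy := norm_ge_0 y).
  assert (E : pencil w0 y = minus (pencil w y) (cs d (plus (dpencil w0 y) (cs d y)))).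
  { replace w with (Cplus w0 d) at 1 by (unfold d; ring). rewrite pencil_shift. cmodule. }
  assert (B : norm (cs d (plus (dpencil w0 y) (cs d y))) <= c * Cmod d * norm y).
  { eapply Rle_trans; [apply norm_cs|]. unfold c.
    replace (kappa * (M + kappa) * Cmod d * norm y)
      with (kappa * Cmod d * ((M + kappa) * norm y)) by ring.
    apply Rmult_le_compat_l; [apply Rmult_le_pos; lra|].
    eapply Rle_trans; [apply normV_plus|]. rewrite Rmult_plus_distr_r.
    apply Rplus_le_compat; [apply Hd; lra|].
    eapply Rle_trans; [apply norm_cs|]. apply Rmult_le_compat_r; [exact Hy|].
    unfold Rgt in Hw1. nra. }
  assert (H := Hlow y). rewrite E in H.
  assert (Htri := normV_minus (pencil w y) (cs d (plus (dpencil w0 y) (cs d y)))).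
  assert (B' : K * (c * Cmod d * norm y) <= / 2 * norm y).
  { replace (K * (c * Cmod d * norm y)) with (K * c * Cmod d * norm y) by ring.
    apply Rmult_le_compat_r; [exact Hy|].
    replace (/ 2) with (K * c * / (2 * K * c)) by (field; lra).
    apply Rmult_le_compat_l; [apply Rmult_le_pos; lra | lra]. }
  assert (K * norm (minus (pencil w y) (cs d (plus (dpencil w0 y) (cs d y)))) <=
          K * (norm (pencil w y) + c * Cmod d * norm y)).
  { apply Rmult_le_compat_l; lra. }
  lra.
Qed.

Variable gs : list (R -> R * R).
Hypothesis gs_jordan : List.Forall jordan_curve gs.
Hypothesis gs_avoids : forall z, on_cycle gs z -> ~ Om z.
Hypothesis gs_winding : forall w, Om w -> fold_right (fun g acc => wind g w + acc) 0 gs = 1.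
Variables (x : V) (f : C -> V).
Hypothesis f_solves : forall s, ~ Om s -> pencil s (f s) = x.

(** The pencil at [s] sends [f s - f s0] to [x] minus its value on [f s0], that is, to the change of
    the pencil between [s0] and [s] on [f s0], up to sign. This is of first order in [s - s0], and
    the lower bound near [s0] concludes. *)
Lemma f_lipschitz s0 : ~ Om s0 -> exists d K, 0 < d /\ forall s, ~ Om s ->
  Cmod (Cminus s s0) < d -> norm (minus (f s) (f s0)) <= K * Cmod (Cminus s s0).
Proof.
  intros Hs0. destruct (pencil_lower_near s0 Hs0) as (d & K & Hd & HK & Hlow).
  destruct (dpencil_bound (Cmod s0) (Cmod_ge_0 s0)) as (M & HM & HdM).
  exists (Rmin 1 d), (K * (kappa * ((M + kappa) * norm (f s0)))).
  split; [apply Rmin_pos; lra|]. intros s Hs Hdist.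
  apply Rmin_Rgt in Hdist; destruct Hdist as [H1 H2].
  set (e := Cminus s s0) in *. assert (He := Cmod_ge_0 e). assert (Hy := norm_ge_0 (f s0)).
  eapply Rle_trans; [apply (Hlow s), H2|]. rewrite !Rmult_assoc.
  apply Rmult_le_compat_l; [lra|].
  rewrite pencil_minus, f_solves by exact Hs.
  replace s with (Cplus s0 e) by (unfold e; ring). rewrite pencil_shift, f_solves by exact Hs0.
  replace (minus x (plus x (cs e (plus (dpencil s0 (f s0)) (cs e (f s0))))))
    with (opp (cs e (plus (dpencil s0 (f s0)) (cs e (f s0))))) by cmodule.
  rewrite normV_opp. eapply Rle_trans; [apply norm_cs|]. rewrite Rmult_assoc.
  apply Rmult_le_compat_l; [lra|].
  rewrite (Rmult_comm (Cmod e)), <- Rmult_assoc.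
  apply Rmult_le_compat_r; [exact He|].
  eapply Rle_trans; [apply normV_plus|]. rewrite Rmult_plus_distr_r.
  apply Rplus_le_compat; [apply HdM; lra|].
  eapply Rle_trans; [apply norm_cs|]. apply Rmult_le_compat_r; [exact Hy|].
  unfold Rgt in H1. nra.
Qed.

Lemma f_cont_on_cycle : cont_on_cycle gs f.
Proof.
  intros g Hg. apply (cont_on_lipschitz (V := V) g).
  - apply (proj1 (Forall_forall _ _) gs_jordan g Hg).
  - intros t Ht. destruct (f_lipschitz (g t)) as (d & K & Hd & H).
    { apply gs_avoids. exists g; split; [exact Hg | exists t; auto]. }
    exists d, K. split; [exact Hd|]. intros s Hs. apply H.
    apply gs_avoids. exists g; split; [exact Hg | exists s; auto].
Qed.

Lemma ex_cint_f (psi : C -> C) : (forall g, In g gs -> ccont (fun t => psi (g t))) ->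
  exists v, is_cint gs (fun s => cs (psi s) (f s)) v.
Proof.
  intros H. apply ex_cint; [exact gs_jordan|].
  apply cont_on_cycle_cs; [exact H | exact f_cont_on_cycle].
Qed.

Lemma Om_not_on_cycle w : Om w -> ~ on_cycle gs w.
Proof. intros H H'. apply (gs_avoids w H' H). Qed.

Lemma ccont_cycle_inv w g : Om w -> In g gs -> ccont (fun t => Cinv (Cminus (g t) w)).
Proof.
  intros Hw Hg. apply ccont_curve_inv.
  - apply (proj1 (Forall_forall _ _) gs_jordan g Hg).
  - intros t Ht E. apply (Om_not_on_cycle w Hw). exists g; split; [exact Hg | exists t; auto].
Qed.

(** * Gluing the Cauchy integral to the solution outside *)

Section Gluing.
Variables I0 I1 : V.
Hypothesis I0_int : is_cint gs f I0.
Hypothesis I1_int : is_cint gs (fun s => cs s (f s)) I1.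

(** The affine function [p] of the overview for arbitrary candidates [I0] and [I1]; the pair
    [(0, 2 * PI)] is the number [2 pi i]. *)
Definition defect (w : C) : V :=
  minus (cs (0, 2 * PI) x) (minus (plus (cs w I0) I1) (A I0)).

Lemma defect_shift w d : defect (Cplus w d) = minus (defect w) (cs d I0).
Proof. unfold defect. cmodule. Qed.

Lemma defect_bound : exists P, 0 < P /\ forall w, norm (defect w) <= P * (1 + Cmod w).
Proof.
  set (v := minus (cs (0, 2 * PI) x) (minus I1 (A I0))).
  assert (H1 := norm_ge_0 v). assert (H2 := norm_ge_0 I0).
  exists (norm v + kappa * norm I0 + 1). split; [nra|]. intros w.
  replace (defect w) with (minus v (cs w I0)) by (unfold defect, v; cmodule).
  eapply Rle_trans; [apply normV_minus|].
  assert (H := norm_cs w I0). assert (Hw := Cmod_ge_0 w).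
  assert (0 <= kappa * norm I0) by (apply Rmult_le_pos; lra). nra.
Qed.

(* On [Om] the Cauchy integral of [f] and its derivative, off [Om] the solution
   of the same equations: this is what glues to an entire function. *)
Definition glued (w : C) (y : V * V) : Prop :=
  pencil w (fst y) = defect w /\
  pencil w (snd y) = minus (opp I0) (dpencil w (fst y)) /\
  (Om w -> is_cint gs (fun s => cs (Cinv (Cminus s w)) (f s)) (fst y) /\
     is_cint gs (fun s => cs (Cmult (Cinv (Cminus s w)) (Cinv (Cminus s w))) (f s)) (snd y)).

(** Off [Om] surjectivity of the pencil supplies both vectors. On [Om] the pencil is taken under the
    integral sign, where [pencil_diff] cancels one factor [s - w] of the Cauchy kernel. *)
Lemma glued_exists w : exists y, glued w y.
Proof.
  destruct (classic (Om w)) as [Hw|Hw].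
  2: { destruct (pencil_onto w Hw (defect w)) as (y & Hy).
       destruct (pencil_onto w Hw (minus (opp I0) (dpencil w y))) as (y1 & Hy1).
       exists (y, y1). repeat split; [exact Hy | exact Hy1 | |]; contradiction. }
  destruct (ex_cint_f (fun s => Cinv (Cminus s w))) as (y & Hy).
  { intros g Hg. apply ccont_cycle_inv; assumption. }
  destruct (ex_cint_f (fun s => Cmult (Cinv (Cminus s w)) (Cinv (Cminus s w)))) as (y1 & Hy1).
  { intros g Hg. apply (ccont_mult (fun t => Cinv (Cminus (g t) w)) (fun t => Cinv (Cminus (g t) w)));
      apply ccont_cycle_inv; assumption. }
  exists (y, y1). unfold glued; cbn [fst snd].
  assert (Hcyc : forall s, on_cycle gs s -> Cmult (Cinv (Cminus s w)) (Cminus s w) = 1).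
  { intros s Hs. apply Cinv_l. intros E. apply (Om_not_on_cycle w Hw).
    replace w with s; [exact Hs|]. replace s with (Cplus (Cminus s w) w) by ring.
    rewrite E. ring. }
  assert (Hpt : forall s, on_cycle gs s ->
    pencil w (cs (Cinv (Cminus s w)) (f s)) =
    minus (cs (Cinv (Cminus s w)) x) (minus (plus (cs w (f s)) (cs s (f s))) (A (f s)))).
  { intros s Hs. rewrite pencil_cs, (pencil_diff w s), f_solves by apply gs_avoids, Hs.
    set (u := minus (plus (cs w (f s)) (cs s (f s))) (A (f s))).
    rewrite <- (cs_1 u) at 2. rewrite <- (Hcyc s Hs). cmodule. }
  assert (Hq := is_cint_linear gs (pencil w) _ _ (pencil_linear w) (pencil_cs w) Hy).
  assert (Hq1 := is_cint_linear gs (pencil w) _ _ (pencil_linear w) (pencil_cs w) Hy1).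
  assert (HAI := is_cint_linear gs A _ _ A_linear A_cs I0_int).
  assert (HwI := is_cint_cs gs w _ _ I0_int).
  repeat split; [| |exact Hy|exact Hy1].
  - apply (is_cint_unique gs _ _ _ Hq). unfold defect.
    apply (is_cint_ext gs (fun s => minus (cs (Cinv (Cminus s w)) x)
             (minus (plus (cs w (f s)) (cs s (f s))) (A (f s))))).
    { intros s Hs. symmetry; apply Hpt, Hs. }
    apply is_cint_minus; [|apply is_cint_minus; [apply is_cint_plus|]]; try assumption.
    assert (H := is_cint_inv gs w x gs_jordan (Om_not_on_cycle w Hw)).
    rewrite gs_winding, Rmult_1_r in H by exact Hw. exact H.
  (* Here [(w + s - A) / (s - w) = 1 + (2 w - A) / (s - w)]. The double pole integrates to zero, the
     summand [1] contributes [I0], and the last term contributes [dpencil w y]. *)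
  - apply (is_cint_unique gs _ _ _ Hq1).
    replace (minus (opp I0) (dpencil w y)) with
      (minus (minus (minus (zero : V) I0) (cs (Cplus w w) y)) (opp (A y))) by (unfold dpencil; cmodule).
    replace (opp (A y)) with (cs (Copp 1) (A y)) by cmodule.
    apply (is_cint_ext gs (fun s => minus (minus (minus
      (cs (Cmult (Cinv (Cminus s w)) (Cinv (Cminus s w))) x) (f s))
      (cs (Cplus w w) (cs (Cinv (Cminus s w)) (f s))))
      (cs (Copp 1) (A (cs (Cinv (Cminus s w)) (f s)))))).
    { intros s Hs.
      assert (Ef : f s = cs (Cmult (Cinv (Cminus s w)) (Cminus s w)) (f s)).
      { rewrite (Hcyc s Hs). symmetry; apply cs_1. }
      rewrite (cs_mult (Cinv (Cminus s w)) (Cinv (Cminus s w)) (f s)).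
      rewrite (pencil_cs w (Cinv (Cminus s w)) (cs (Cinv (Cminus s w)) (f s))), (Hpt s Hs), A_cs.
      rewrite Ef at 1. cmodule. }
    apply is_cint_minus; [apply is_cint_minus; [apply is_cint_minus|]|].
    + apply is_cint_inv2; [exact gs_jordan | apply Om_not_on_cycle, Hw].
    + exact I0_int.
    + apply is_cint_cs, Hy.
    + apply is_cint_cs. apply (is_cint_linear gs A _ _ A_linear A_cs Hy).
Qed.

Variables h h1 : C -> V.
Hypothesis h_glued : forall w, glued w (h w, h1 w).

(** The Taylor remainder of the kernel [1 / (s - w)] is integrated against [f], which is bounded on
    the cycle. *)
Lemma taylor_inside w0 : Om w0 -> exists eta, 0 < eta /\
  forall w d, Cmod (Cminus w w0) < 2 * eta -> Cmod d < eta ->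
    norm (minus (minus (h (Cplus w d)) (h w)) (cs d (h1 w))) <= / eta * (Cmod d * Cmod d).
Proof.
  intros Hw0. destruct (Om_open w0 Hw0) as (eps & Heps & Hball).
  destruct (cont_on_cycle_bounded gs f f_cont_on_cycle) as (Mf & HMf & Hf).
  destruct (is_cint_norm gs gs_jordan) as (L & HL & Hint).
  (* All points used lie within [3 * eta <= 3 * eps / 4] of [w0], and the cycle stays at distance
     [eps] at least, so [q] bounds the kernel; its third power comes from the remainder. *)
  set (q := / (eps / 4)).
  assert (Hq : 0 < q) by (apply Rinv_0_lt_compat; lra).
  set (c := L * (kappa * (q * q * q) * Mf)).
  assert (Hc : 0 <= c).
  { unfold c. repeat apply Rmult_le_pos; lra. }
  (* The second entry forces [c <= / eta]; adding [1] covers [c = 0]. *)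
  set (eta := Rmin (eps / 4) (/ (c + 1))).
  assert (Heta : 0 < eta) by (apply Rmin_pos; [lra | apply Rinv_0_lt_compat; lra]).
  assert (Heta1 : eta <= eps / 4) by apply Rmin_l.
  assert (Heta2 : c <= / eta).
  { apply (Rle_trans _ (c + 1)); [lra|]. rewrite <- (Rinv_inv (c + 1)).
    apply Rinv_le_contravar; [exact Heta | apply Rmin_r]. }
  exists eta. split; [exact Heta|]. intros w d Hw Hd.
  assert (Hd0 := Cmod_ge_0 d).
  assert (Hww0 : Cmod (Cminus (Cplus w d) w0) < 3 * eta).
  { replace (Cminus (Cplus w d) w0) with (Cplus (Cminus w w0) d) by ring.
    eapply Rle_lt_trans; [apply Cmod_triangle|]. lra. }
  assert (Omw : Om w) by (apply Hball; lra).
  assert (Omwd : Om (Cplus w d)) by (apply Hball; lra).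
  assert (Hfar : forall s z, on_cycle gs s -> Cmod (Cminus z w0) < 3 * eta ->
    Cminus s z <> 0 /\ Cmod (Cinv (Cminus s z)) <= q).
  { intros s z Hs Hz.
    assert (Hdist : eps / 4 <= Cmod (Cminus s z)).
    { apply Rnot_lt_le. intros Hlt. apply (gs_avoids s Hs), Hball.
      replace (Cminus s w0) with (Cplus (Cminus s z) (Cminus z w0)) by ring.
      eapply Rle_lt_trans; [apply Cmod_triangle|]. lra. }
    assert (Hnz : Cminus s z <> 0) by (apply Cmod_gt_0; lra).
    split; [exact Hnz|]. rewrite Cmod_inv by exact Hnz.
    apply Rinv_le_contravar; lra. }
  destruct (h_glued w) as (_ & _ & Hgl). destruct (Hgl Omw) as [Hh Hh1].
  destruct (h_glued (Cplus w d)) as (_ & _ & Hgl'). destruct (Hgl' Omwd) as [Hh' _].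
  cbn [fst snd] in *.
  assert (Hr := is_cint_minus _ _ _ _ _ (is_cint_minus _ _ _ _ _ Hh' Hh) (is_cint_cs _ d _ _ Hh1)).
  apply (Rle_trans _ (c * (Cmod d * Cmod d))); [|apply Rmult_le_compat_r; nra].
  replace (c * (Cmod d * Cmod d)) with
    (L * (kappa * (q * q * q) * (Cmod d * Cmod d) * Mf)) by (unfold c; ring).
  refine (Hint _ _ _ _ _ Hr).
  { repeat apply Rmult_le_pos; lra. }
  intros s Hs. cbv beta.
  destruct (Hfar s w Hs ltac:(lra)) as [Hn Hb].
  destruct (Hfar s (Cplus w d) Hs Hww0) as [Hn' Hb'].
  set (a := Cinv (Cminus s w)) in *. set (b := Cinv (Cminus s (Cplus w d))) in *.
  (* 1/(s-w-d) - 1/(s-w) - d/(s-w)^2 = d^2 / ((s-w)^2 (s-w-d)) *)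
  assert (Eab : Cminus (Cminus b a) (Cmult d (Cmult a a)) = Cmult (Cmult d d) (Cmult (Cmult a a) b)).
  { unfold a, b. field. split; assumption. }
  replace (minus (minus (cs b (f s)) (cs a (f s))) (cs d (cs (Cmult a a) (f s))))
    with (cs (Cmult (Cmult d d) (Cmult (Cmult a a) b)) (f s)).
  2: { rewrite <- Eab. cmodule. }
  eapply Rle_trans; [apply norm_cs|]. rewrite !Cmod_mult.
  assert (Ha0 := Cmod_ge_0 a). assert (Hb0 := Cmod_ge_0 b).
  apply Rmult_le_compat; [| apply norm_ge_0 | | apply Hf, Hs].
  - repeat apply Rmult_le_pos; lra.
  - replace (kappa * (q * q * q) * (Cmod d * Cmod d))
      with (kappa * (Cmod d * Cmod d * (q * q * q))) by ring.
    apply Rmult_le_compat_l; [lra|]. apply Rmult_le_compat_l; [apply Rmult_le_pos; lra|].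
    repeat apply Rmult_le_compat; try lra; repeat apply Rmult_le_pos; lra.
Qed.

(** [w0] may be a boundary point, with [w] and [w + d] on either side, so only the two equations of
    [glued] and the lower bound are used. The difference [e] of the two values of [h] has pencil
    value of order [d], so [e] is of order [d]. In the pencil value of [e - d h1] the terms linear
    in [d] cancel, up to [dpencil w e], and order [d^2] remains. *)
Lemma taylor_outside w0 : ~ Om w0 -> exists eta, 0 < eta /\
  forall w d, Cmod (Cminus w w0) < 2 * eta -> Cmod d < eta ->
    norm (minus (minus (h (Cplus w d)) (h w)) (cs d (h1 w))) <= / eta * (Cmod d * Cmod d).
Proof.
  intros Hw0. destruct (pencil_lower_near w0 Hw0) as (del & K & Hdel & HK & Hlow).
  (* Since [eta <= 1], every point within [3 * eta] of [w0] has modulus at most [W]. Below, [b0]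
     bounds [h] there, [e1] is a Lipschitz constant and [c] the second-order constant. *)
  set (W := Cmod w0 + 3). assert (HW : 0 < W) by (unfold W; generalize (Cmod_ge_0 w0); lra).
  destruct (dpencil_bound W ltac:(lra)) as (M & HM & HdM).
  destruct defect_bound as (P & HP & Hdef).
  set (b0 := K * (P * (1 + W))).
  assert (Hb0 : 0 < b0) by (unfold b0; repeat apply Rmult_lt_0_compat; lra).
  set (e1 := K * (kappa * (norm I0 + M * b0 + kappa * b0))).
  assert (HI0 := norm_ge_0 I0).
  assert (He1 : 0 <= e1).
  { unfold e1. repeat apply Rmult_le_pos; try lra.
    assert (0 < M * b0) by (apply Rmult_lt_0_compat; lra).
    assert (0 < kappa * b0) by (apply Rmult_lt_0_compat; lra). lra. }
  set (c := K * (kappa * (M * e1 + kappa * b0))).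
  assert (Hc : 0 <= c).
  { unfold c. repeat apply Rmult_le_pos; try lra.
    assert (0 <= M * e1) by (apply Rmult_le_pos; lra).
    assert (0 < kappa * b0) by (apply Rmult_lt_0_compat; lra). lra. }
  set (eta := Rmin (Rmin 1 (del / 3)) (/ (c + 1))).
  assert (Heta : 0 < eta).
  { repeat apply Rmin_pos; try lra. apply Rinv_0_lt_compat; lra. }
  assert (Heta1 : eta <= 1) by (eapply Rle_trans; [apply Rmin_l | apply Rmin_l]).
  assert (Heta3 : eta <= del / 3) by (eapply Rle_trans; [apply Rmin_l | apply Rmin_r]).
  assert (Heta2 : c <= / eta).
  { apply (Rle_trans _ (c + 1)); [lra|]. rewrite <- (Rinv_inv (c + 1)).
    apply Rinv_le_contravar; [exact Heta | apply Rmin_r]. }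
  exists eta. split; [exact Heta|]. intros w d Hw Hd.
  assert (Hd0 := Cmod_ge_0 d).
  assert (Hww0 : Cmod (Cminus (Cplus w d) w0) < 3 * eta).
  { replace (Cminus (Cplus w d) w0) with (Cplus (Cminus w w0) d) by ring.
    eapply Rle_lt_trans; [apply Cmod_triangle|]. lra. }
  assert (Hsize : forall z, Cmod (Cminus z w0) < 3 * eta -> Cmod z <= W).
  { intros z Hz. replace z with (Cplus (Cminus z w0) w0) by ring.
    eapply Rle_trans; [apply Cmod_triangle|]. unfold W. lra. }
  assert (Hhb : forall z, Cmod (Cminus z w0) < 3 * eta -> norm (h z) <= b0).
  { intros z Hz. eapply Rle_trans; [apply (Hlow z); lra|].
    destruct (h_glued z) as (Ez & _). cbn [fst] in Ez. rewrite Ez. apply Rmult_le_compat_l; [lra|].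
    eapply Rle_trans; [apply Hdef|]. apply Rmult_le_compat_l; [lra|].
    specialize (Hsize z Hz). lra. }
  destruct (h_glued w) as (Eh & Eh1 & _). destruct (h_glued (Cplus w d)) as (Eh' & _).
  cbn [fst snd] in *. rewrite pencil_shift, defect_shift in Eh'.
  set (h' := h (Cplus w d)) in *. set (e := minus h' (h w)).
  assert (Hh' : norm h' <= b0) by (apply Hhb; lra).
  assert (HwW : Cmod w <= W) by (apply Hsize; lra).
  assert (Eh'' : pencil w h' = minus (minus (defect w) (cs d I0))
                   (cs d (plus (dpencil w h') (cs d h')))).
  { rewrite <- Eh'. cmodule. }
  assert (Ee : pencil w e = opp (cs d (plus (plus I0 (dpencil w h')) (cs d h')))).
  { unfold e. rewrite pencil_minus, Eh'', Eh. cmodule. }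
  assert (He : norm e <= e1 * Cmod d).
  { eapply Rle_trans; [apply (Hlow w); lra|]. rewrite Ee, normV_opp.
    unfold e1. rewrite Rmult_assoc. apply Rmult_le_compat_l; [lra|].
    eapply Rle_trans; [apply norm_cs|]. rewrite !Rmult_assoc.
    apply Rmult_le_compat_l; [lra|]. rewrite Rmult_comm.
    apply Rmult_le_compat_r; [lra|].
    eapply Rle_trans; [apply normV_plus|]. apply Rplus_le_compat.
    - eapply Rle_trans; [apply normV_plus|]. apply Rplus_le_compat_l.
      eapply Rle_trans; [apply HdM, HwW|]. apply Rmult_le_compat_l; lra.
    - eapply Rle_trans; [apply norm_cs|].
      apply Rmult_le_compat; [apply Rmult_le_pos; lra | apply norm_ge_0 | nra | exact Hh']. }
  apply (Rle_trans _ (c * (Cmod d * Cmod d))); [|apply Rmult_le_compat_r; nra].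
  eapply Rle_trans; [apply (Hlow w); lra|]. unfold c. rewrite Rmult_assoc.
  apply Rmult_le_compat_l; [lra|]. fold e.
  replace (pencil w (minus e (cs d (h1 w)))) with (opp (cs d (plus (dpencil w e) (cs d h')))).
  2: { rewrite pencil_minus, pencil_cs, Ee, Eh1. unfold e, dpencil. rewrite A_minus. cmodule. }
  rewrite normV_opp. eapply Rle_trans; [apply norm_cs|]. rewrite !Rmult_assoc.
  apply Rmult_le_compat_l; [lra|].
  replace ((M * e1 + kappa * b0) * (Cmod d * Cmod d))
    with (Cmod d * (M * (e1 * Cmod d) + kappa * Cmod d * b0)) by ring.
  apply Rmult_le_compat_l; [lra|].
  eapply Rle_trans; [apply normV_plus|]. apply Rplus_le_compat.
  - eapply Rle_trans; [apply HdM, HwW|]. apply Rmult_le_compat_l; lra.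
  - eapply Rle_trans; [apply norm_cs|]. apply Rmult_le_compat_l; [|exact Hh'].
    apply Rmult_le_pos; lra.
Qed.

(** For large [w] the term [w^2 h] dominates the pencil while [defect] grows only linearly. With
    [r = Cmod w] this reads [r * n <= 2 * (kappa * P) + c * n], and [r >= 2 * c] absorbs the last
    term, so [h] is of order [1 / r]. *)
Lemma glued_decay eps : 0 < eps -> exists rad, forall w, rad <= Cmod w -> norm (h w) <= eps.
Proof.
  intros Heps.
  destruct (linear_bound A A_linear) as (MA & HMA & HA).
  destruct (linear_bound N N_linear) as (MN & HMN & HN).
  destruct defect_bound as (P & HP & Hdef).
  set (c := kappa * (kappa * MA + MN)).
  assert (Hc : 0 < c).
  { unfold c. apply Rmult_lt_0_compat; [lra|].
    assert (0 < kappa * MA) by (apply Rmult_lt_0_compat; lra). lra. }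
  assert (HkP : 0 < kappa * P) by (apply Rmult_lt_0_compat; lra).
  exists (1 + 2 * c + 4 * (kappa * P) / eps). intros w Hw.
  assert (Hq : 0 < 4 * (kappa * P) / eps) by (apply Rdiv_lt_0_compat; lra).
  set (r := Cmod w) in *. set (n := norm (h w)). assert (Hn : 0 <= n) by apply norm_ge_0.
  assert (E : cs (Cmult w w) (h w) = plus (minus (defect w) (N (h w))) (cs w (A (h w)))).
  { destruct (h_glued w) as (Ew & _). cbn [fst] in Ew. rewrite <- Ew. unfold pencil. cmodule. }
  assert (H := norm_cs_lower (Cmult w w) (h w)). rewrite Cmod_mult in H. fold r n in H.
  rewrite E in H.
  assert (B : norm (plus (minus (defect w) (N (h w))) (cs w (A (h w)))) <=
              P * (2 * r) + MN * n + kappa * r * (MA * n)).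
  { eapply Rle_trans; [apply normV_plus|]. apply Rplus_le_compat.
    - eapply Rle_trans; [apply normV_minus|]. apply Rplus_le_compat; [|apply HN].
      eapply Rle_trans; [apply Hdef|]. apply Rmult_le_compat_l; fold r; lra.
    - eapply Rle_trans; [apply norm_cs|]. fold r.
      apply Rmult_le_compat_l; [apply Rmult_le_pos; lra | apply HA]. }
  assert (H' : r * (r * n) <= r * (2 * (kappa * P) + c * n)).
  { replace (r * (r * n)) with (r * r * n) by ring. eapply Rle_trans; [exact H|].
    eapply Rle_trans; [apply Rmult_le_compat_l; [lra | exact B]|].
    assert (0 <= kappa * (MN * n)) by (repeat apply Rmult_le_pos; lra).
    unfold c. nra. }
  apply Rmult_le_reg_l in H'; [|lra].
  assert (H2 : r * n <= 4 * (kappa * P)) by nra.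
  assert (H3 : 4 * (kappa * P) / eps * n <= 4 * (kappa * P)) by nra.
  apply (Rmult_le_reg_l (4 * (kappa * P) / eps)); [exact Hq|].
  eapply Rle_trans; [exact H3|]. right; field; lra.
Qed.

Lemma defect_zero w : defect w = zero.
Proof.
  assert (Hloc : locally_taylor h h1).
  { intros w0. destruct (classic (Om w0)); [apply taylor_inside | apply taylor_outside]; assumption. }
  destruct (h_glued w) as (Ew & _). cbn [fst] in Ew. rewrite <- Ew.
  rewrite (liouville h h1 Hloc glued_decay w).
  rewrite <- (cs_0 zero) at 1. rewrite pencil_cs. apply cs_0.
Qed.
End Gluing.

Lemma pencil_moments01 :
  is_cint gs f zero /\ is_cint gs (fun s => cs s (f s)) (cs (0, 2 * PI) x).
Proof.
  destruct (ex_cint gs f gs_jordan f_cont_on_cycle) as (I0 & H0).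
  destruct (ex_cint_f (fun s => s)) as (I1 & H1).
  { intros g Hg. apply ccont_curve. apply (proj1 (Forall_forall _ _) gs_jordan g Hg). }
  (* One pair is chosen at each [w] without any regularity; the two Taylor lemmas derive it from
     [glued]. *)
  assert (Hch : forall w, {y | glued I0 I1 w y}).
  { intros w. apply constructive_indefinite_description, glued_exists; assumption. }
  assert (D := defect_zero I0 I1 (fun w => fst (proj1_sig (Hch w))) (fun w => snd (proj1_sig (Hch w)))).
  assert (D' : forall w, defect I0 I1 w = zero).
  { apply D. intros w. rewrite <- surjective_pairing. apply (proj2_sig (Hch w)). }
  assert (E0 : I0 = zero).
  (* An affine function with slope [- I0] drops by [I0] from [0] to [1]. *)
  { replace I0 with (minus (defect I0 I1 0) (defect I0 I1 1)).
    - rewrite !D'. cmodule.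
    - unfold defect. rewrite cs_0, cs_1. cmodule. }
  assert (E1 : I1 = cs (0, 2 * PI) x).
  { replace I1 with (minus (cs (0, 2 * PI) x) (minus (defect I0 I1 0) (A I0))).
    - rewrite D', E0. rewrite <- (cs_0 zero) at 2. rewrite A_cs, cs_0. cmodule.
    - unfold defect. rewrite cs_0. cmodule. }
  split; [rewrite <- E0 | rewrite <- E1]; assumption.
Qed.

Theorem pencil_moments (H : nat -> V) :
  H 0%nat = zero -> H 1%nat = cs (0, 2 * PI) x ->
  (forall k, H (S (S k)) = minus (A (H (S k))) (N (H k))) ->
  forall k, is_cint gs (fun s => cs (s ^ k)%C (f s)) (H k).
Proof.
  intros H0 H1 HS.
  (* The recurrence has depth two, so two consecutive moments are carried along. *)
  assert (HH : forall k, is_cint gs (fun s => cs (s ^ k)%C (f s)) (H k) /\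
                         is_cint gs (fun s => cs (s ^ S k)%C (f s)) (H (S k))).
  2: { intros k; apply HH. }
  destruct pencil_moments01 as [J0 J1].
  induction k as [|k [IH0 IH1]].
  - rewrite H0, H1. split.
    + apply (is_cint_ext gs f); [|exact J0]. intros s _. symmetry; apply cs_1.
    + apply (is_cint_ext gs (fun s => cs s (f s))); [|exact J1].
      intros s _. simpl. f_equal. ring.
  - split; [exact IH1|].
    assert (K1 := is_cint_linear gs A _ _ A_linear A_cs IH1).
    assert (K0 := is_cint_linear gs N _ _ N_linear N_cs IH0).
    assert (K2 := is_cint_plus gs _ _ _ _ (is_cint_minus gs _ _ _ _ K1 K0)
                    (is_cint_pow gs k x gs_jordan)).
    rewrite <- HS, plus_zero_r in K2.
    refine (is_cint_ext gs _ _ _ _ K2).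
    intros s Hs. cbv beta. rewrite <- (f_solves s) by apply gs_avoids, Hs.
    unfold pencil. rewrite A_cs, N_cs. simpl Cpow. cmodule.
Qed.
End QuadraticPencil.

End ComplexModule.

(** * The quaternionic module *)

Section ProductComplete.
Variables U W : CompleteNormedModule R_AbsRing.

Definition prod_lim (F : (U * W -> Prop) -> Prop) : U * W :=
  (lim (filtermap fst F), lim (filtermap snd F)).

Lemma prod_complete_cauchy (F : (U * W -> Prop) -> Prop) :
  ProperFilter F -> cauchy (T := prod_UniformSpace U W) F ->
  forall eps : posreal, F (ball (M := prod_UniformSpace U W) (prod_lim F) eps).
Proof.
  intros HF HC eps.
  assert (H1 : filtermap fst F (ball (lim (filtermap fst F)) eps)).
  { apply complete_cauchy; [apply filtermap_proper_filter, HF|].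
    intros e. destruct (HC e) as [[u w] H]. exists u. unfold filtermap.
    eapply filter_imp; [|exact H]. intros y [Hy _]; exact Hy. }
  assert (H2 : filtermap snd F (ball (lim (filtermap snd F)) eps)).
  { apply complete_cauchy; [apply filtermap_proper_filter, HF|].
    intros e. destruct (HC e) as [[u w] H]. exists w. unfold filtermap.
    eapply filter_imp; [|exact H]. intros y [_ Hy]; exact Hy. }
  unfold filtermap in H1, H2.
  eapply filter_imp; [|apply (filter_and _ _ H1 H2)].
  intros y [Hy1 Hy2]. split; assumption.
Qed.

Lemma prod_complete_close (F1 F2 : (U * W -> Prop) -> Prop) :
  filter_le F1 F2 -> filter_le F2 F1 ->
  close (M := prod_UniformSpace U W) (prod_lim F1) (prod_lim F2).
Proof.
  intros H12 H21 eps. split.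
  - exact (close_lim (filtermap fst F1) (filtermap fst F2)
             (fun P HP => H12 _ HP) (fun P HP => H21 _ HP) eps).
  - exact (close_lim (filtermap snd F1) (filtermap snd F2)
             (fun P HP => H12 _ HP) (fun P HP => H21 _ HP) eps).
Qed.

Definition prod_complete_mixin :=
  CompleteSpace.Mixin (prod_UniformSpace U W) prod_lim prod_complete_cauchy prod_complete_close.

Definition prod_CompleteNormedModule : CompleteNormedModule R_AbsRing :=
  CompleteNormedModule.Pack R_AbsRing (U * W)
    (CompleteNormedModule.Class R_AbsRing (U * W)
       (NormedModule.class R_AbsRing (prod_NormedModule R_AbsRing U W)) prod_complete_mixin)
    (U * W).
End ProductComplete.

Section RealModule.
Variable X : CompleteNormedModule R_AbsRing.

(** The square-zero extension once more, now over [R], so that [ring] decides linear identities in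
    [X]. *)
Definition rext : Type := (R * X)%type.
Definition rext_add (p q : rext) : rext := (fst p + fst q, plus (snd p) (snd q)).
Definition rext_opp (p : rext) : rext := (- fst p, opp (snd p)).
Definition rext_sub (p q : rext) : rext := rext_add p (rext_opp q).
Definition rext_mul (p q : rext) : rext :=
  (fst p * fst q, plus (scal (fst p) (snd q)) (scal (fst q) (snd p))).
Definition rext_scalar (r : R) : rext := (r, zero).
Definition rext_vector (v : X) : rext := (0, v).

Lemma scalX_plus_r (r : R) (v w : X) : scal r (plus v w) = plus (scal r v) (scal r w).
Proof. exact (scal_distr_l (K := R_Ring) (V := X) r v w). Qed.
Lemma scalX_plus_l (r s : R) (v : X) : scal (r + s) v = plus (scal r v) (scal s v).
Proof. exact (scal_distr_r (K := R_Ring) (V := X) r s v). Qed.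
Lemma scalX_mult (r s : R) (v : X) : scal (r * s) v = scal r (scal s v).
Proof. exact (eq_sym (scal_assoc (K := R_Ring) (V := X) r s v)). Qed.
Lemma scalX_0 (v : X) : scal 0 v = (zero : X).
Proof. exact (scal_zero_l (K := R_Ring) (V := X) v). Qed.
Lemma scalX_1 (v : X) : scal 1 v = v.
Proof. exact (scal_one (K := R_Ring) (V := X) v). Qed.
Lemma scalX_zero (r : R) : scal r (zero : X) = (zero : X).
Proof. exact (scal_zero_r (K := R_Ring) (V := X) r). Qed.
Lemma plusX_opp (v : X) : plus v (opp v) = (zero : X).
Proof. exact (plus_opp_r (G := X) v). Qed.
Lemma oppX_zero : opp (zero : X) = (zero : X).
Proof. exact (opp_zero (G := X)). Qed.
Lemma rext_ring_theory :
  ring_theory (rext_scalar 0) (rext_scalar 1) rext_add rext_mul rext_sub rext_opp eq.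
Proof.
  split; intros; unfold rext_sub, rext_add, rext_mul, rext_opp, rext_scalar; simpl;
    try destruct x as [a x]; try destruct y as [b y]; try destruct z as [c z]; simpl;
    try reflexivity; f_equal; try ring.
  - apply plus_zero_l.
  - apply plus_comm.
  - apply plus_assoc.
  - rewrite scalX_zero, plus_zero_r. apply scalX_1.
  - apply plus_comm.
  - rewrite !scalX_plus_r, <- !scalX_mult, !plus_assoc. f_equal.
    + f_equal. f_equal; ring.
    + f_equal; ring.
  - rewrite scalX_plus_l, scalX_plus_r, <- !plus_assoc. f_equal.
    rewrite !plus_assoc. f_equal. apply plus_comm.
  - apply plusX_opp.
Qed.

Add Ring rext_ring : rext_ring_theory.

Lemma rext_vector_inj v w : rext_vector v = rext_vector w -> v = w.
Proof. intros H; injection H; auto. Qed.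
Lemma rext_vector_plus v w : rext_vector (plus v w) = rext_add (rext_vector v) (rext_vector w).
Proof. unfold rext_vector, rext_add; simpl; f_equal; ring. Qed.
Lemma rext_vector_opp v : rext_vector (opp v) = rext_opp (rext_vector v).
Proof. unfold rext_vector, rext_opp; simpl; f_equal; ring. Qed.
Lemma rext_vector_minus v w : rext_vector (minus v w) = rext_sub (rext_vector v) (rext_vector w).
Proof. unfold minus, rext_sub. rewrite rext_vector_plus, rext_vector_opp; reflexivity. Qed.
Lemma rext_vector_zero : rext_vector zero = rext_scalar 0.
Proof. reflexivity. Qed.
Lemma rext_vector_scal (r : R) v : rext_vector (scal r v) = rext_mul (rext_scalar r) (rext_vector v).
Proof.
  unfold rext_vector, rext_mul, rext_scalar; simpl.
  rewrite scalX_0, plus_zero_r; f_equal; ring.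
Qed.
Lemma rext_scalar_plus r s : rext_scalar (r + s) = rext_add (rext_scalar r) (rext_scalar s).
Proof. unfold rext_scalar, rext_add; simpl. rewrite plus_zero_r; reflexivity. Qed.
Lemma rext_scalar_opp r : rext_scalar (- r) = rext_opp (rext_scalar r).
Proof. unfold rext_scalar, rext_opp; simpl. rewrite oppX_zero; reflexivity. Qed.
Lemma rext_scalar_minus r s : rext_scalar (r - s) = rext_sub (rext_scalar r) (rext_scalar s).
Proof. unfold Rminus, rext_sub. rewrite rext_scalar_plus, rext_scalar_opp; reflexivity. Qed.
Lemma rext_scalar_mult r s : rext_scalar (r * s) = rext_mul (rext_scalar r) (rext_scalar s).
Proof. unfold rext_scalar, rext_mul; simpl. rewrite !scalX_zero, plus_zero_r; reflexivity. Qed.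

Ltac rmodule :=
  apply rext_vector_inj;
  repeat rewrite ?rext_vector_plus, ?rext_vector_minus, ?rext_vector_opp, ?rext_vector_scal,
    ?rext_vector_zero, ?rext_scalar_plus, ?rext_scalar_opp, ?rext_scalar_minus, ?rext_scalar_mult;
  ring.

(** * The quaternionic module and its operators with four components *)

Definition X2 : CompleteNormedModule R_AbsRing := prod_CompleteNormedModule X X.
(* The module [X (x) H], with real components [((v0, v1), (v2, v3))]. *)
Definition X4 : CompleteNormedModule R_AbsRing := prod_CompleteNormedModule X2 X2.

Definition quad (a b c d : X) : X4 := ((a, b), (c, d)).
Definition v0 (v : X4) : X := fst (fst v).
Definition v1 (v : X4) : X := snd (fst v).
Definition v2 (v : X4) : X := fst (snd v).
Definition v3 (v : X4) : X := snd (snd v).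

Lemma quad_plus a b c d a' b' c' d' :
  plus (quad a b c d) (quad a' b' c' d') = quad (plus a a') (plus b b') (plus c c') (plus d d').
Proof. reflexivity. Qed.
Lemma quad_opp a b c d : opp (quad a b c d) = quad (opp a) (opp b) (opp c) (opp d).
Proof. reflexivity. Qed.
Lemma quad_scal (r : R) a b c d :
  scal r (quad a b c d) = quad (scal r a) (scal r b) (scal r c) (scal r d).
Proof. reflexivity. Qed.

(** Each [Ai] acts on the coefficients and [ei] multiplies the units from the left, by Hamilton's
    table. *)
Definition act (A : qop X) (v : X4) : X4 :=
  quad
    (plus (plus (plus (o0 A (v0 v)) (opp (o1 A (v1 v)))) (opp (o2 A (v2 v)))) (opp (o3 A (v3 v))))
    (plus (plus (plus (o0 A (v1 v)) (o1 A (v0 v))) (o2 A (v3 v))) (opp (o3 A (v2 v))))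
    (plus (plus (plus (o0 A (v2 v)) (opp (o1 A (v3 v)))) (o2 A (v0 v))) (o3 A (v1 v)))
    (plus (plus (plus (o0 A (v3 v)) (o1 A (v2 v))) (opp (o2 A (v1 v)))) (o3 A (v0 v))).

(** For bounded [A] this is its value on [x (x) 1], see [act_real]; by right linearity such values
    determine the operator. *)
Definition vec (A : qop X) (x : X) : X4 := quad (o0 A x) (o1 A x) (o2 A x) (o3 A x).

Lemma vec_mul A B x : vec (qop_mul A B) x = act A (vec B x).
Proof. reflexivity. Qed.

Definition lift (L : X -> X) (v : X4) : X4 := quad (L (v0 v)) (L (v1 v)) (L (v2 v)) (L (v3 v)).

Definition lmul (q : quat) (v : X4) : X4 := act (qconst X q) v.

Section BoundedOperators.
Variable f : X -> X.
Hypothesis Hf : is_bop X f.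

Lemma bop_plus x y : f (plus x y) = plus (f x) (f y).
Proof. apply Hf. Qed.
Lemma bop_scal (r : R) x : f (scal r x) = scal r (f x).
Proof. apply Hf. Qed.
Lemma bop_zero : f zero = (zero : X).
Proof. rewrite <- (scalX_0 zero), bop_scal. rewrite !scalX_0; reflexivity. Qed.
Lemma bop_opp x : f (opp x) = opp (f x).
Proof.
  replace (opp x) with (scal (- (1)) x) by rmodule. rewrite bop_scal. rmodule.
Qed.
Lemma bop_linear : is_linear f.
Proof.
  destruct Hf as (Hp & Hs & M & HM). split; [exact Hp | exact Hs |].
  exists (Rabs M + 1). split; [generalize (Rabs_pos M); lra|].
  intros x. eapply Rle_trans; [apply HM|].
  apply Rmult_le_compat_r; [apply norm_ge_0|]. generalize (Rle_abs M); lra.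
Qed.
End BoundedOperators.

Lemma is_bop_comp (f g : X -> X) : is_bop X f -> is_bop X g -> is_bop X (fun x => f (g x)).
Proof.
  intros Hf Hg. assert (Lf := bop_linear f Hf). assert (Lg := bop_linear g Hg).
  assert (L := is_linear_comp g f Lg Lf). split; [|split].
  - apply (linear_plus _ L).
  - apply (linear_scal _ L).
  - destruct (linear_norm _ L) as (M & _ & HM). exists M; exact HM.
Qed.

Lemma is_bop_plus (f g : X -> X) : is_bop X f -> is_bop X g -> is_bop X (fun x => plus (f x) (g x)).
Proof.
  intros Hf Hg. split; [|split].
  - intros x y. rewrite (bop_plus f Hf), (bop_plus g Hg). rmodule.
  - intros r x. rewrite (bop_scal f Hf), (bop_scal g Hg). rmodule.
  - destruct Hf as (_ & _ & M & HM). destruct Hg as (_ & _ & M' & HM').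
    exists (M + M'). intros x. eapply Rle_trans; [exact (norm_triangle (V := X) (f x) (g x))|].
    specialize (HM x). specialize (HM' x). lra.
Qed.

Lemma is_bop_opp (f : X -> X) : is_bop X f -> is_bop X (fun x => opp (f x)).
Proof.
  intros Hf. split; [|split].
  - intros x y. rewrite (bop_plus f Hf). rmodule.
  - intros r x. rewrite (bop_scal f Hf). rmodule.
  - destruct Hf as (_ & _ & M & HM). exists M. intros x.
    eapply Rle_trans; [right; exact (norm_opp (V := X) (f x)) | apply HM].
Qed.

Lemma qop_add_bounded (A B : qop X) :
  qop_bounded A -> qop_bounded B -> qop_bounded (qop_add A B).
Proof.
  intros (A0 & A1 & A2 & A3) (B0 & B1 & B2 & B3). split; [|split; [|split]]; apply is_bop_plus; assumption.
Qed.

Lemma qop_sub_bounded (A B : qop X) :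
  qop_bounded A -> qop_bounded B -> qop_bounded (qop_sub A B).
Proof.
  intros (A0 & A1 & A2 & A3) (B0 & B1 & B2 & B3).
  split; [|split; [|split]]; (apply is_bop_plus; [|apply is_bop_opp]); assumption.
Qed.

Lemma qop_mul_bounded (A B : qop X) :
  qop_bounded A -> qop_bounded B -> qop_bounded (qop_mul A B).
Proof.
  intros (A0 & A1 & A2 & A3) (B0 & B1 & B2 & B3).
  split; [|split; [|split]]; unfold qop_mul, fsub, fadd, fcomp; cbn [o0 o1 o2 o3];
    repeat (apply is_bop_plus || apply is_bop_opp); apply is_bop_comp; assumption.
Qed.

Lemma qop_conj_bounded (A : qop X) : qop_bounded A -> qop_bounded (qop_conj A).
Proof.
  intros (A0 & A1 & A2 & A3). split; [|split; [|split]]; try apply is_bop_opp; assumption.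
Qed.

Lemma is_bop_scal (r : R) : is_bop X (fscal X r (fid X)).
Proof.
  unfold fscal, fid. split; [|split].
  - intros; rmodule.
  - intros; rmodule.
  - exists (Rabs r). intros x. exact (norm_scal (K := R_AbsRing) (V := X) r x).
Qed.

Lemma qconst_bounded q : qop_bounded (qconst X q).
Proof. repeat split; apply is_bop_scal. Qed.

Lemma quad_ext a b c d a' b' c' d' :
  a = a' -> b = b' -> c = c' -> d = d' -> quad a b c d = quad a' b' c' d'.
Proof. intros -> -> -> ->; reflexivity. Qed.

Lemma quad_eta (v : X4) : v = quad (v0 v) (v1 v) (v2 v) (v3 v).
Proof. destruct v as [[a b] [c d]]; reflexivity. Qed.

Lemma v0_quad a b c d : v0 (quad a b c d) = a. Proof. reflexivity. Qed.
Lemma v1_quad a b c d : v1 (quad a b c d) = b. Proof. reflexivity. Qed.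
Lemma v2_quad a b c d : v2 (quad a b c d) = c. Proof. reflexivity. Qed.
Lemma v3_quad a b c d : v3 (quad a b c d) = d. Proof. reflexivity. Qed.

Ltac coords v :=
  rewrite (quad_eta v);
  generalize (v0 v) (v1 v) (v2 v) (v3 v); let a := fresh "a" in let b := fresh "b" in
  let c := fresh "c" in let d := fresh "d" in intros a b c d; clear v;
  unfold lmul, act, lift, vec;
  unfold emb, qconst, qop_mul, qop_add, qop_sub, qop_conj, qop_one, qreal,
    qmul, qadd, qscal, qopp, fsub, fadd, fcomp, fopp, fscal, fid, fzero;
  cbn [o0 o1 o2 o3 q0 q1 q2 q3];
  repeat rewrite ?v0_quad, ?v1_quad, ?v2_quad, ?v3_quad, ?quad_plus, ?quad_opp, ?quad_scal;
  apply quad_ext.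

Lemma act_mul A B v : qop_bounded A -> act (qop_mul A B) v = act A (act B v).
Proof.
  intros (H0 & H1 & H2 & H3). coords v;
    rewrite ?(bop_plus _ H0), ?(bop_plus _ H1), ?(bop_plus _ H2), ?(bop_plus _ H3),
      ?(bop_opp _ H0), ?(bop_opp _ H1), ?(bop_opp _ H2), ?(bop_opp _ H3); rmodule.
Qed.

Lemma act_add A B v : act (qop_add A B) v = plus (act A v) (act B v).
Proof. coords v; rmodule. Qed.

Lemma act_sub A B v : act (qop_sub A B) v = plus (act A v) (opp (act B v)).
Proof. coords v; rmodule. Qed.

Lemma act_one v : act (qop_one X) v = v.
Proof. coords v; rmodule. Qed.

Lemma act_eq A B v : qop_eq A B -> act A v = act B v.
Proof.
  intros E.
  assert (E0 : forall x, o0 A x = o0 B x) by (intros x; apply (E x)).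
  assert (E1 : forall x, o1 A x = o1 B x) by (intros x; apply (E x)).
  assert (E2 : forall x, o2 A x = o2 B x) by (intros x; apply (E x)).
  assert (E3 : forall x, o3 A x = o3 B x) by (intros x; apply (E x)).
  unfold act. rewrite ?E0, ?E1, ?E2, ?E3. reflexivity.
Qed.

Lemma act_real A x : qop_bounded A -> act A (quad x zero zero zero) = vec A x.
Proof.
  intros (H0 & H1 & H2 & H3). unfold act, vec.
  rewrite v0_quad, v1_quad, v2_quad, v3_quad.
  rewrite ?(bop_zero _ H0), ?(bop_zero _ H1), ?(bop_zero _ H2), ?(bop_zero _ H3).
  apply quad_ext; rmodule.
Qed.

Lemma lmul_lmul p q v : lmul p (lmul q v) = lmul (qmul p q) v.
Proof. coords v; rmodule. Qed.

(** A real operator acts on the factor [X] and a quaternion on the factor [H]. This is the source of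
    complex linearity for the operators [A] and [N] of the pencil. *)
Lemma lmul_lift q L v : is_bop X L -> lift L (lmul q v) = lmul q (lift L v).
Proof.
  intros H. coords v;
    rewrite ?(bop_plus _ H), ?(bop_opp _ H), ?(bop_plus _ H), ?(bop_opp _ H), ?(bop_scal _ H); rmodule.
Qed.

Lemma lmul_minus1 v : lmul (qreal (- (1))) v = opp v.
Proof. coords v; rmodule. Qed.

Lemma is_linear_quad (l0 l1 l2 l3 : X4 -> X) :
  is_linear l0 -> is_linear l1 -> is_linear l2 -> is_linear l3 ->
  is_linear (fun v => quad (l0 v) (l1 v) (l2 v) (l3 v)).
Proof.
  intros H0 H1 H2 H3.
  exact (is_linear_prod _ _ (is_linear_prod l0 l1 H0 H1) (is_linear_prod l2 l3 H2 H3)).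
Qed.

Lemma is_linear_add (l l' : X4 -> X) :
  is_linear l -> is_linear l' -> is_linear (fun v => plus (l v) (l' v)).
Proof.
  intros H H'. exact (is_linear_comp _ _ (is_linear_prod l l' H H') is_linear_plus).
Qed.

Lemma is_linear_neg (l : X4 -> X) : is_linear l -> is_linear (fun v => opp (l v)).
Proof. intros H. exact (is_linear_comp _ _ H is_linear_opp). Qed.

Lemma v0_linear : is_linear v0.
Proof.
  exact (is_linear_comp _ _ (is_linear_fst (U := X2) (V := X2)) (is_linear_fst (U := X) (V := X))).
Qed.
Lemma v1_linear : is_linear v1.
Proof.
  exact (is_linear_comp _ _ (is_linear_fst (U := X2) (V := X2)) (is_linear_snd (U := X) (V := X))).
Qed.
Lemma v2_linear : is_linear v2.
Proof.
  exact (is_linear_comp _ _ (is_linear_snd (U := X2) (V := X2)) (is_linear_fst (U := X) (V := X))).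
Qed.
Lemma v3_linear : is_linear v3.
Proof.
  exact (is_linear_comp _ _ (is_linear_snd (U := X2) (V := X2)) (is_linear_snd (U := X) (V := X))).
Qed.

Lemma is_linear_bop (f : X -> X) (l : X4 -> X) :
  is_bop X f -> is_linear l -> is_linear (fun v => f (l v)).
Proof. intros Hf Hl. exact (is_linear_comp l f Hl (bop_linear f Hf)). Qed.

Lemma act_linear A : qop_bounded A -> is_linear (act A).
Proof.
  intros (H0 & H1 & H2 & H3). apply is_linear_quad;
  repeat first [apply is_linear_add | apply is_linear_neg];
  apply is_linear_bop; first [assumption | apply v0_linear | apply v1_linear
    | apply v2_linear | apply v3_linear].
Qed.

Lemma lift_linear L : is_bop X L -> is_linear (lift L).
Proof.
  intros H. apply is_linear_quad; apply is_linear_bop;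
    first [assumption | apply v0_linear | apply v1_linear | apply v2_linear | apply v3_linear].
Qed.

(** * The pencil of [T] on one slice *)

Section SliceFunctionalCalculus.
Variable T : qop X.
Hypothesis HT : in_BC T.
Variable J : quat.
Hypothesis HJ : in_S J.

Lemma T_bounded : qop_bounded T.
Proof. apply HT. Qed.

Lemma T_commute i k x : (i < 4)%nat -> (k < 4)%nat -> oc T i (oc T k x) = oc T k (oc T i x).
Proof. intros; apply HT; assumption. Qed.

(** [J] squares to [-1], so [emb J] is a homomorphism from [C] onto the slice; all scalars of the
    integrand commute for this reason. *)
Lemma qmul_emb z w : qmul (emb J z) (emb J w) = emb J (Cmult z w).
Proof.
  destruct HJ as [H0 H1]. destruct J as [j0 j1 j2 j3]. simpl in H0, H1. subst j0.
  unfold qmul, emb, qadd, qreal, qscal; simpl. f_equal; try ring.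
  transitivity (fst z * fst w - snd z * snd w * (j1 ^ 2 + j2 ^ 2 + j3 ^ 2)); [simpl; ring|].
  simpl. rewrite H1. ring.
Qed.

Definition jmul : X4 -> X4 := lmul J.

Lemma jmul_linear : is_linear jmul.
Proof. apply act_linear, qconst_bounded. Qed.

Lemma emb_Ci : emb J Ci = J.
Proof.
  destruct HJ as [H0 _]. destruct J as [j0 j1 j2 j3]. simpl in H0. subst j0.
  unfold emb, qadd, qreal, qscal, Ci; simpl. f_equal; ring.
Qed.

Lemma jmul_square v : jmul (jmul v) = opp v.
Proof.
  unfold jmul. rewrite lmul_lmul, <- lmul_minus1. f_equal.
  rewrite <- emb_Ci at 1 2. rewrite qmul_emb.
  unfold emb, qadd, qreal, qscal, Ci, Cmult; simpl. f_equal; ring.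
Qed.

Lemma cs_lmul c v : cs X4 jmul c v = lmul (emb J c) v.
Proof. unfold cs, jmul. coords v; rmodule. Qed.

(** [Tsum] and the following [Tnorm] are the real operators behind [T + conj T] and [T conj T];
    their lifts serve as [A] and [N]. *)
Definition Tsum (x : X) : X := plus (o0 T x) (o0 T x).
Definition Tnorm (x : X) : X :=
  plus (plus (plus (o0 T (o0 T x)) (o1 T (o1 T x))) (o2 T (o2 T x))) (o3 T (o3 T x)).

Lemma Tsum_bop : is_bop X Tsum.
Proof. apply is_bop_plus; apply T_bounded. Qed.

Lemma Tnorm_bop : is_bop X Tnorm.
Proof. repeat apply is_bop_plus; apply is_bop_comp; apply T_bounded. Qed.

Lemma act_Tsum v : plus (act T v) (act (qop_conj T) v) = lift Tsum v.
Proof. unfold Tsum. coords v; rmodule. Qed.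

Ltac sort_T :=
  assert (C10 := fun x => T_commute 1 0 x ltac:(lia) ltac:(lia));
  assert (C20 := fun x => T_commute 2 0 x ltac:(lia) ltac:(lia));
  assert (C30 := fun x => T_commute 3 0 x ltac:(lia) ltac:(lia));
  assert (C21 := fun x => T_commute 2 1 x ltac:(lia) ltac:(lia));
  assert (C31 := fun x => T_commute 3 1 x ltac:(lia) ltac:(lia));
  assert (C32 := fun x => T_commute 3 2 x ltac:(lia) ltac:(lia));
  cbn [oc] in C10, C20, C30, C21, C31, C32;
  destruct T_bounded as (H0 & H1 & H2 & H3);
  repeat rewrite ?(bop_plus _ H0), ?(bop_plus _ H1), ?(bop_plus _ H2), ?(bop_plus _ H3),
    ?(bop_opp _ H0), ?(bop_opp _ H1), ?(bop_opp _ H2), ?(bop_opp _ H3);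
  rewrite ?C10, ?C20, ?C30, ?C21, ?C31, ?C32.

(** For distinct imaginary units [ei ej = - ej ei], while [Ti] and [Tj] commute, so the mixed terms
    cancel and only the squares are left. The opposite order, treated next, is the one needed for
    the recurrence. *)
Lemma act_T_Tconj v : act T (act (qop_conj T) v) = lift Tnorm v.
Proof. unfold Tnorm. coords v; sort_T; rmodule. Qed.

Lemma act_Tconj_T v : act (qop_conj T) (act T v) = lift Tnorm v.
Proof. unfold Tnorm. coords v; sort_T; rmodule. Qed.

Lemma act_Qcs w v : act (Qcs T (emb J w)) v = pencil X4 jmul (lift Tsum) (lift Tnorm) w v.
Proof.
  unfold Qcs, pencil, minus.
  rewrite act_add, act_sub, (act_mul (qconst X _)), (act_mul T), act_add, act_Tsum, act_T_Tconj.
  2: exact T_bounded. 2: apply qconst_bounded.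
  rewrite !cs_lmul, <- qmul_emb. reflexivity.
Qed.

Lemma lift_cs L c v : is_bop X L -> lift L (cs X4 jmul c v) = cs X4 jmul c (lift L v).
Proof. intros H. rewrite !cs_lmul. apply lmul_lift, H. Qed.

Lemma Qcs_bounded s : qop_bounded (Qcs T s).
Proof.
  assert (H := T_bounded). assert (H' := qop_conj_bounded T H). unfold Qcs.
  apply qop_add_bounded; [apply qop_sub_bounded|].
  - apply qconst_bounded.
  - apply qop_mul_bounded; [apply qconst_bounded | apply qop_add_bounded; assumption].
  - apply qop_mul_bounded; assumption.
Qed.

Section Inverse.
Variables (w : C) (B : qop X).
Hypothesis HB : is_bounded_inverse (Qcs T (emb J w)) B.

Lemma pencil_act_inverse v : pencil X4 jmul (lift Tsum) (lift Tnorm) w (act B v) = v.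
Proof.
  destruct HB as (_ & HQB & _).
  rewrite <- act_Qcs, <- act_mul by apply Qcs_bounded.
  rewrite (act_eq _ _ v HQB). apply act_one.
Qed.

Lemma act_inverse_pencil v : act B (pencil X4 jmul (lift Tsum) (lift Tnorm) w v) = v.
Proof.
  destruct HB as (HBb & _ & HBQ).
  rewrite <- act_Qcs, <- act_mul by exact HBb.
  rewrite (act_eq _ _ v HBQ). apply act_one.
Qed.

(** The inverse of a complex-linear map is complex-linear: write [c B v] as [B] applied to the
    pencil of [c B v], which is [c v]. *)
Lemma act_inverse_cs c v : act B (cs X4 jmul c v) = cs X4 jmul c (act B v).
Proof.
  rewrite <- (act_inverse_pencil (cs X4 jmul c (act B v))).
  rewrite pencil_cs, pencil_act_inverse; [reflexivity | ..];
    first [exact jmul_linear | exact jmul_square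
      | intros; apply lift_cs; first [exact Tsum_bop | exact Tnorm_bop]].
Qed.

Lemma pencil_lower_of_inverse :
  exists K, 0 < K /\ forall y, norm y <= K * norm (pencil X4 jmul (lift Tsum) (lift Tnorm) w y).
Proof.
  destruct HB as (HBb & _ & _).
  destruct (linear_bound X4 (act B) (act_linear B HBb)) as (K & HK & H).
  exists K. split; [exact HK|]. intros y.
  rewrite <- (act_inverse_pencil y) at 1. apply H.
Qed.
End Inverse.

(** * The recurrence for the sums [H_m(T)] *)

Definition Hvec (m : nat) (x : X) : X4 := vec (Hm T m) x.

Lemma vec_add A B x : vec (qop_add A B) x = plus (vec A x) (vec B x).
Proof. reflexivity. Qed.

Lemma act_plus A v w : qop_bounded A -> act A (plus v w) = plus (act A v) (act A w).
Proof. intros H. apply (linear_plus _ (act_linear A H)). Qed.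

(** Raising [m] by one puts a further factor [T] on the left of every summand; [n <= m] keeps the
    exponents [m - k] from being truncated. *)
Lemma Hsum_S m n x : (n <= m)%nat -> vec (Hsum T (S m) n) x = act T (vec (Hsum T m n) x).
Proof.
  induction n; intros Hn.
  - reflexivity.
  - change (Hsum T (S m) (S n)) with (qop_add (Hsum T (S m) n)
      (qop_mul (qop_pow T (S m - S n)) (qop_pow (qop_conj T) (S n)))).
    change (Hsum T m (S n)) with (qop_add (Hsum T m n)
      (qop_mul (qop_pow T (m - S n)) (qop_pow (qop_conj T) (S n)))).
    rewrite !vec_add, act_plus by exact T_bounded. rewrite IHn by lia. f_equal.
    replace (S m - S n)%nat with (S (m - S n)) by lia.
    rewrite !vec_mul. change (qop_pow T (S (m - S n))) with (qop_mul T (qop_pow T (m - S n))).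
    apply act_mul, T_bounded.
Qed.

Lemma Hvec_S m x :
  Hvec (S m) x = plus (act T (Hvec m x)) (vec (qop_pow (qop_conj T) (S m)) x).
Proof.
  unfold Hvec, Hm.
  change (Hsum T (S m) (S m)) with (qop_add (Hsum T (S m) m)
    (qop_mul (qop_pow T (S m - S m)) (qop_pow (qop_conj T) (S m)))).
  rewrite vec_add, Hsum_S by lia. f_equal.
  rewrite Nat.sub_diag, vec_mul. apply act_one.
Qed.

Lemma Hvec_1 x : Hvec 1 x = lift Tsum (Hvec 0 x).
Proof. rewrite Hvec_S, <- act_Tsum. reflexivity. Qed.

(** By [Hvec_S], [H_{m+1} - T H_m] is the power [m + 1] of [conj T]. Hence
    [(T + conj T) H_{m+1} - conj T T H_m] equals [T H_{m+1}] plus the next power, which is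
    [H_{m+2}]. *)
Lemma Hvec_SS m x :
  Hvec (S (S m)) x = minus (lift Tsum (Hvec (S m) x)) (lift Tnorm (Hvec m x)).
Proof.
  rewrite (Hvec_S (S m)), <- act_Tsum.
  change (qop_pow (qop_conj T) (S (S m))) with
    (qop_mul (qop_conj T) (qop_pow (qop_conj T) (S m))).
  rewrite vec_mul, <- act_Tconj_T.
  assert (H := qop_conj_bounded T T_bounded).
  rewrite (Hvec_S m) at 3. rewrite (act_plus (qop_conj T)) by exact H.
  generalize (act T (Hvec (S m) x)) (act (qop_conj T) (act T (Hvec m x)))
    (act (qop_conj T) (vec (qop_pow (qop_conj T) (S m)) x)).
  intros u v w. unfold minus.
  rewrite (quad_eta u), (quad_eta v), (quad_eta w).
  repeat rewrite ?quad_plus, ?quad_opp. apply quad_ext; rmodule.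
Qed.

(** * The contour integral over the boundary of the slice *)

Variable U : quat -> Prop.
Hypothesis U_open : qopen U.
Hypothesis spectrum_in_U : forall s, S_spectrum T s -> U s.
Variable gs : list (R -> R * R).
Hypothesis gs_boundary : jordan_boundary J U gs.
Hypothesis gs_oriented : pos_oriented J U gs.

Definition slice (w : C) : Prop := U (emb J w).

Lemma qnorm2_emb z w : qnorm2 (qadd (emb J z) (qopp (emb J w))) = Defs.d2 z w.
Proof.
  destruct HJ as [H0 H1]. destruct J as [j0 j1 j2 j3]. simpl in H0, H1. subst j0.
  unfold qnorm2, qadd, qopp, emb, qreal, qscal, Defs.d2; simpl.
  transitivity ((fst z - fst w) ^ 2 + (snd z - snd w) ^ 2 * (j1 ^ 2 + j2 ^ 2 + j3 ^ 2));
    [simpl; ring|]. simpl. rewrite H1. ring.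
Qed.

Lemma d2_Cmod z w : Defs.d2 z w = Cmod (Cminus z w) ^ 2.
Proof.
  unfold Cmod, Defs.d2. rewrite pow2_sqrt.
  - unfold Cminus, Cplus, Copp; simpl. ring.
  - generalize (pow2_ge_0 (fst (Cminus z w))) (pow2_ge_0 (snd (Cminus z w))). lra.
Qed.

Lemma slice_open w : slice w -> exists eps, 0 < eps /\ forall z, Cmod (Cminus z w) < eps -> slice z.
Proof.
  intros Hw. destruct (U_open _ Hw) as (eps & He & H). exists eps. split; [exact He|].
  intros z Hz. apply H. rewrite qnorm2_emb, d2_Cmod.
  assert (H0 := Cmod_ge_0 (Cminus z w)). simpl; nra.
Qed.

(** A boundary point is a limit of points outside [U], which openness forbids for points of [U].
    Thus the curves avoid the spectrum. *)
Lemma boundary_not_slice z : on_cycle gs z -> ~ slice z.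
Proof.
  intros Hz HO. destruct (slice_open z HO) as (eps & He & H).
  destruct gs_boundary as (_ & _ & Hb). apply Hb in Hz.
  destruct (Hz eps He) as [_ (w & Hw & Hn)]. apply Hn, H.
  rewrite d2_Cmod in Hw. assert (H0 := Cmod_ge_0 (Cminus w z)). simpl in Hw; nra.
Qed.

Lemma Qinv_inverse w : ~ slice w -> is_bounded_inverse (Qcs T (emb J w)) (Qinv T (emb J w)).
Proof.
  intros Hw. unfold Qinv. apply epsilon_spec.
  apply NNPP. intros Hn. apply Hw, spectrum_in_U, Hn.
Qed.

Definition Qinv_vec (x : X) (s : C) : X4 := act (Qinv T (emb J s)) (quad x zero zero zero).

Lemma norm_cs_X4 :
  exists K, 0 < K /\ forall c v, norm (cs X4 jmul c v) <= K * Cmod c * norm v.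
Proof.
  destruct (linear_bound X4 jmul jmul_linear) as (M & HM & HjM).
  exists (1 + M). split; [lra|].
  intros c v. unfold cs. eapply Rle_trans; [apply normV_plus|].
  assert (Hm := Rmax_Cmod c).
  assert (H1 := Rmax_l (Rabs (fst c)) (Rabs (snd c))).
  assert (H2 := Rmax_r (Rabs (fst c)) (Rabs (snd c))).
  assert (E1 : norm (scal (fst c) v) <= Rabs (fst c) * norm v)
    by exact (norm_scal (K := R_AbsRing) (V := X4) (fst c) v).
  assert (E2 : norm (scal (snd c) (jmul v)) <= Rabs (snd c) * norm (jmul v))
    by exact (norm_scal (K := R_AbsRing) (V := X4) (snd c) (jmul v)).
  assert (E3 := HjM v). assert (Hv := norm_ge_0 v). assert (Hs := Rabs_pos (snd c)).
  assert (Rabs (fst c) * norm v <= Cmod c * norm v) by (apply Rmult_le_compat_r; lra).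
  assert (Rabs (snd c) * norm (jmul v) <= Cmod c * (M * norm v)).
  { apply Rmult_le_compat; [lra | apply norm_ge_0 | lra | exact E3]. }
  lra.
Qed.

Lemma cs_X4_linear c : is_linear (cs X4 jmul c).
Proof.
  destruct norm_cs_X4 as (K & HK & H).
  exact (cs_linear X4 jmul jmul_linear jmul_square K HK H c).
Qed.

Lemma Qinv_moments x k :
  is_cint X4 jmul gs (fun s => cs X4 jmul (s ^ S k)%C (Qinv_vec x s))
    (cs X4 jmul (0, 2 * PI) (Hvec k x)).
Proof.
  destruct norm_cs_X4 as (K & HK & Hcs).
  (* The sequence is shifted by one: index [S k] carries [2 pi i H_k], and the value [zero] at index
     [0] stands for [H_{-1}(T) = 0], which extends the recurrence down to [H_1 = A H_0]. *)
  set (H := fun k => match k with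
                     | O => (zero : X4)
                     | S k => cs X4 jmul (0, 2 * PI) (Hvec k x) end).
  change (cs X4 jmul (0, 2 * PI) (Hvec k x)) with (H (S k)).
  apply (pencil_moments X4 jmul jmul_linear jmul_square K HK Hcs) with
    (A := lift Tsum) (N := lift Tnorm) (Om := slice) (x := quad x zero zero zero).
  - apply lift_linear, Tsum_bop.
  - apply lift_linear, Tnorm_bop.
  - intros; apply lift_cs, Tsum_bop.
  - intros; apply lift_cs, Tnorm_bop.
  - exact slice_open.
  - intros w Hw. apply (pencil_lower_of_inverse w _ (Qinv_inverse w Hw)).
  - intros w Hw z. exists (act (Qinv T (emb J w)) z).
    apply pencil_act_inverse, Qinv_inverse, Hw.
  - apply gs_boundary.
  - exact boundary_not_slice.
  - intros w Hw. apply gs_oriented, Hw.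
  - intros s Hs. apply pencil_act_inverse, Qinv_inverse, Hs.
  - reflexivity.
  - reflexivity.
  - intros [|n]; unfold H.
    + rewrite lift_cs by exact Tsum_bop. rewrite <- Hvec_1.
      assert (E : lift Tnorm zero = zero) by apply (linear_zero _ (lift_linear _ Tnorm_bop)).
      rewrite E. symmetry. apply (minus_zero_r (G := X4)).
    + rewrite !lift_cs, Hvec_SS by (exact Tsum_bop || exact Tnorm_bop).
      apply (linear_minus (cs X4 jmul (0, 2 * PI))), cs_X4_linear.
Qed.

Definition comp (i : nat) : X4 -> X :=
  match i with O => v0 | 1%nat => v1 | 2%nat => v2 | _ => v3 end.

Lemma comp_linear i : is_linear (comp i).
Proof.
  destruct i as [|[|[|i]]];
    [apply v0_linear | apply v1_linear | apply v2_linear | apply v3_linear].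
Qed.

Lemma oc_comp A i x : oc A i x = comp i (vec A x).
Proof. destruct i as [|[|[|i]]]; reflexivity. Qed.

Lemma qpow_emb s n : qpow (emb J s) n = emb J (s ^ n)%C.
Proof.
  induction n; simpl.
  - unfold emb, qadd, qreal, qscal; simpl. f_equal; ring.
  - rewrite IHn. apply qmul_emb.
Qed.

Lemma qopp_J : qopp J = emb J (Copp Ci).
Proof.
  rewrite <- emb_Ci at 1. unfold emb, qopp, qadd, qreal, qscal, Ci; simpl. f_equal; ring.
Qed.

(** The integrand multiplies by the quaternion before the inverse is applied. As [ds], [-J] and
    [s^{m+1}] all lie in the slice, [act_inverse_cs] moves them in front of the inverse. *)
Lemma integrand_comp m g i x t : ~ slice (g t) ->
  integrand T m J g i x t =
  comp i (cs X4 jmul (velocity g t)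
            (cs X4 jmul (Copp Ci) (cs X4 jmul (g t ^ S m)%C (Qinv_vec x (g t))))).
Proof.
  intros Ht. unfold integrand. cbv zeta. rewrite oc_comp, vec_mul. f_equal.
  rewrite <- (act_real (qconst X _)) by apply qconst_bounded.
  rewrite qopp_J, qpow_emb, !qmul_emb.
  change (act (qconst X ?q) ?v) with (lmul q v). rewrite <- cs_lmul.
  rewrite (act_inverse_cs (g t) _ (Qinv_inverse (g t) Ht)).
  rewrite !(cs_mult X4 jmul jmul_linear jmul_square). reflexivity.
Qed.

Lemma is_cint_list F v : is_cint X4 jmul gs F v ->
  exists vs, Forall2 (fun g v => is_lint X4 jmul g F v) gs vs /\ v = fold_right plus zero vs.
Proof.
  clear gs_boundary gs_oriented. revert v; induction gs as [|g l IH]; intros v.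
  - intros ->. exists nil. split; [constructor | reflexivity].
  - intros (u1 & u2 & H1 & H2 & ->). destruct (IH u2 H2) as (vs & Hvs & ->).
    exists (u1 :: vs). split; [constructor; assumption | reflexivity].
Qed.

Lemma Forall2_map_r {P Q S : Type} (RR : P -> Q -> Prop) (SS : P -> S -> Prop) (h : Q -> S) l l' :
  (forall a b, In a l -> RR a b -> SS a (h b)) -> Forall2 RR l l' -> Forall2 SS l (map h l').
Proof.
  intros H HR; induction HR; constructor.
  - apply H; [left; reflexivity | assumption].
  - apply IHHR. intros; apply H; [right|]; assumption.
Qed.

Lemma comp_fold i vs :
  comp i (fold_right plus zero vs) = fold_right plus zero (map (comp i) vs).
Proof.
  induction vs as [|v vs IH]; simpl.
  - apply (linear_zero _ (comp_linear i)).
  - etransitivity; [apply (linear_plus _ (comp_linear i))|]. exact (f_equal (plus _) IH).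
Qed.

Lemma Hm_integral m i x : exists vs : list X,
  Forall2 (fun g v => is_RInt (integrand T m J g i x) 0 1 v) gs vs /\
  oc (Hm T m) i x = scal (/ (2 * PI)) (fold_right plus zero vs).
Proof.
  destruct norm_cs_X4 as (K & HK & Hcs).
  assert (H := is_cint_cs X4 jmul jmul_linear jmul_square K HK Hcs gs (Copp Ci) _ _
                 (Qinv_moments x m)).
  rewrite <- (cs_mult X4 jmul jmul_linear jmul_square) in H.
  (* The factor [-J] of [ds_J] turns [2 pi J] into the real number [2 pi], which the normalisation
     divides out. *)
  replace (Cmult (Copp Ci) (0, 2 * PI)) with (RtoC (2 * PI)) in H
    by (unfold RtoC, Cmult, Copp, Ci; simpl; f_equal; ring).
  destruct (is_cint_list _ _ H) as (vs & Hvs & E).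
  exists (map (comp i) vs). split.
  - revert Hvs. apply Forall2_map_r. intros g v Hg Hv.
    apply (is_RInt_ext (fun t => comp i (cs X4 jmul (velocity g t)
             (cs X4 jmul (Copp Ci) (cs X4 jmul (g t ^ S m)%C (Qinv_vec x (g t))))))).
    + rewrite Rmin_left, Rmax_right by lra. intros t Ht. symmetry.
      apply integrand_comp, boundary_not_slice. exists g. split; [exact Hg|].
      exists t. split; [lra | reflexivity].
    + apply (is_RInt_linear (comp i)); [apply comp_linear | exact Hv].
  - rewrite <- comp_fold, <- E, oc_comp. fold (Hvec m x).
    rewrite cs_real. rewrite <- (linear_scal _ (comp_linear i)). f_equal.
    rewrite <- (cs_real X4 jmul), <- (cs_real X4 jmul).
    rewrite <- (cs_mult X4 jmul jmul_linear jmul_square), <- RtoC_mult, Rinv_l.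
    + symmetry. apply cs_1.
    + generalize PI_RGT_0; lra.
Qed.
End SliceFunctionalCalculus.
End RealModule.

Theorem theorem8p1 (X : CompleteNormedModule R_AbsRing) (T : qop X) (m : nat)
    (U : quat -> Prop) :
  in_BC T -> qbounded U -> slice_cauchy_domain U ->
  (forall s, S_spectrum T s -> U s) ->
  forall J, in_S J ->
  forall gs : list (R -> R * R), jordan_boundary J U gs -> pos_oriented J U gs ->
  forall (i : nat) (x : X), (i < 4)%nat ->
    exists vs : list X,
      List.Forall2 (fun g v => is_RInt (integrand T m J g i x) 0 1 v) gs vs /\
      oc (Hm T m) i x = scal (/ (2 * PI)) (fold_right plus zero vs).
Proof.
  intros HT _ (HU & _) Hspec J HJ gs Hgs Hor i x _.
  exact (Hm_integral X T HT J HJ U HU Hspec gs Hgs Hor m i x).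
Qed.
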